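(* Let $n \in \{1,2,3,\dots\}$ and let $\Omega \subset \mathbb{R}^n$ be a non-empty open set such that, for every $\bar{p} \in \mathcal{L}$, the self-adjoint operator $A_{\bar{p}}$ in $L^2_{\mathbb{C}}(\Omega)$ is strictly positive. Let $(\bar{p}_\nu)_{\nu \geq 1}$ be a sequence in $\mathcal{L}$ that is monotonically decreasing, i.e., such that for every integer $\nu \geq 1$ the inequality $\bar{p}_{\nu+1}(x) \leq \bar{p}_\nu(x)$ holds for almost all $x \in \Omega$. For each $\nu$, let $A_\nu := A_{\bar{p}_\nu}$ be the associated self-adjoint linear operator. Then the sequence $A_1^{-1}, A_2^{-1}, \dots$ is strongly convergent to a positive bounded self-adjoint linear operator on $L^2_{\mathbb{C}}(\Omega)$; that is, there is a bounded self-adjoint linear operator $T$ on $L^2_{\mathbb{C}}(\Omega)$ with $\langle f | T f\rangle_2 \geq 0$ for every $f \in L^2_{\mathbb{C}}(\Omega)$ such that $\lim_{\nu \to \infty} \|A_\nu^{-1} f - T f\|_2 = 0$ for every $f \in L^2_{\mathbb{C}}(\Omega)$.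
   Context: $L^2_{\mathbb{C}}(\Omega)$ is the Hilbert space of (classes of) complex-valued square-integrable functions on $\Omega$, with scalar product $\langle f | g \rangle_2 = \int_\Omega \overline{f}\, g \, dx$ and norm $\|\cdot\|_2$. $W^1_{0,\mathbb{C}}(\Omega)$ is the closure of $C_0^\infty(\Omega,\mathbb{C})$ in the complex Sobolev space $W^1_{\mathbb{C}}(\Omega)$ of functions in $L^2_{\mathbb{C}}(\Omega)$ with weak first-order partial derivatives in $L^2_{\mathbb{C}}(\Omega)$. $\mathcal{L}$ is the subset of the real-valued $L^\infty(\Omega)$ consisting of those $\bar{p}$ for which there are real $C_1, C_2$ with $C_2 \geq C_1 > 0$ and $C_1 \leq \bar{p} \leq C_2$ almost everywhere on $\Omega$. $\nabla_w$ denotes the weak gradient. $\nabla_0$ denotes the densely-defined gradient operator from $L^2_{\mathbb{C}}(\Omega)$ to $(L^2_{\mathbb{C}}(\Omega))^n$ with domain $C_0^\infty(\Omega,\mathbb{C})$, and $\nabla_0^{*}$ its Hilbert space adjoint (so $\nabla_0^{*}$ acts as the negative weak divergence, on those vector fields in $(L^2_{\mathbb{C}}(\Omega))^n$ whose weak divergence is in $L^2_{\mathbb{C}}(\Omega)$). For $\bar{p} \in \mathcal{L}$, the diffusion operator $A_{\bar{p}} : D(A_{\bar{p}}) \to L^2_{\mathbb{C}}(\Omega)$ is defined by $$D(A_{\bar{p}}) := \{u \in W^1_{0,\mathbb{C}}(\Omega) : (1/\bar{p}) \nabla_w u \in D(\nabla_0^{*})\}, \qquad A_{\bar{p}} u :=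 \nabla_0^{*} (1/\bar{p}) \nabla_w u .$$ It is a densely-defined, linear, self-adjoint operator in $L^2_{\mathbb{C}}(\Omega)$. A self-adjoint operator $A$ is called strictly positive if there is $c > 0$ such that $\langle u | A u \rangle_2 \geq c \|u\|_2^2$ for every $u \in D(A)$; such an $A$ is bijective with bounded inverse $A^{-1}$. *)

(* Defs.v *)
From HB Require Import structures.
From mathcomp Require Import all_boot all_order all_algebra.
From mathcomp Require Import complex.
From mathcomp Require Import all_classical all_reals all_analysis.

Set Implicit Arguments.
Unset Strict Implicit.
Unset Printing Implicit Defensive.

Import Order.TTheory GRing.Theory Num.Theory.
Import numFieldNormedType.Exports.

Local Open Scope classical_set_scope.
Local Open Scope ring_scope.
Local Open Scope complex_scope.

(* The sigma-algebra on row vectors is the one generated by the coordinates,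
   i.e. for T = R the Borel sigma-algebra of R^n. *)
Section measurable_rV.
Context {d : measure_display} {T : measurableType d}.
Variable n : nat.

Let coor (i : 'I_n) (x : 'rV[T]_n) : T := x ord0 i.

Let rV_set0 : g_sigma_preimage coor set0.
Proof. exact: sigma_algebra0. Qed.

Let rV_setC A : g_sigma_preimage coor A -> g_sigma_preimage coor (~` A).
Proof. exact: sigma_algebraC. Qed.

Let rV_bigcup (F : (set 'rV[T]_n)^nat) : (forall i, g_sigma_preimage coor (F i)) ->
  g_sigma_preimage coor (\bigcup_i (F i)).
Proof. exact: sigma_algebra_bigcup. Qed.

HB.instance Definition _ := @isMeasurable.Build (measure_tuple_display d)
  'rV[T]_n (g_sigma_preimage coor) rV_set0 rV_setC rV_bigcup.

Lemma measurable_coor (i : 'I_n) : measurable_fun [set: 'rV[T]_n] (coor i).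
Proof.
move=> _ Y mY; rewrite setTI; apply: sub_sigma_algebra => /=.
rewrite -bigcup_seq/=; exists i => /=; first by rewrite mem_index_enum.
by exists Y => //; rewrite setTI.
Qed.

Lemma measurable_fun_rV d' (S : measurableType d') (f : S -> 'rV[T]_n) :
  (forall i, measurable_fun [set: S] (fun s => f s ord0 i)) ->
  measurable_fun [set: S] f.
Proof.
move=> mf.
have pre : g_sigma_preimage (fun i => coor i \o f) `<=` measurable.
  apply: smallest_sub; first exact: sigma_algebra_measurable.
  rewrite -bigcup_seq => A [i _ [B mB <-]]; exact: mf.
rewrite g_sigma_preimage_comp in pre.
by move=> _ A mA; apply: pre; exists A.
Qed.

End measurable_rV.

Section lebesgue_rV.
Variable R : realType.

Definition rV_cons (n : nat) (z : R * 'rV[R]_n) : 'rV[R]_n.+1 :=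
  \row_i oapp (z.2 ord0) z.1 (unlift ord0 i).

Definition rV_uncons (n : nat) (x : 'rV[R]_n.+1) : R * 'rV[R]_n :=
  (x ord0 ord0, \row_i x ord0 (lift ord0 i)).

Lemma rV_consK (n : nat) : cancel (@rV_cons n) (@rV_uncons n).
Proof.
move=> [a v]; rewrite /rV_uncons /rV_cons mxE unlift_none /=; congr pair.
by apply/rowP => i; rewrite !mxE liftK.
Qed.

Lemma measurable_rV_cons (n : nat) : measurable_fun [set: _] (@rV_cons n).
Proof.
apply: measurable_fun_rV => i.
under eq_fun do rewrite mxE.
case: (unliftP ord0 i) => [j _|_] /=; last exact: measurable_fst.
by apply: (measurableT_comp (measurable_coor j)); exact: measurable_snd.
Qed.

Lemma measurable_rV_uncons (n : nat) : measurable_fun [set: _] (@rV_uncons n).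
Proof.
apply: measurable_fun_pair; first exact: (measurable_coor ord0).
apply: measurable_fun_rV => i; under eq_fun do rewrite mxE.
exact: (measurable_coor (lift ord0 i)).
Qed.

Section rV_product.
Variables (n : nat) (mu : {sigma_finite_measure set 'rV[R]_n -> \bar R}).

Definition rV_product : set 'rV[R]_n.+1 -> \bar R :=
  pushforward (lebesgue_measure \x mu)%E (@rV_cons n).

HB.instance Definition _ := Measure.copy rV_product
  (measure_function_pushforward__canonical__measure_function_Measure
    (lebesgue_measure \x mu)%E (@measurable_rV_cons n)).

Let rV_product_sigma_finite : sigma_finite setT rV_product.
Proof.
have /sigma_finiteP[F [TF ndF Foo]] := sigma_finiteT (@lebesgue_measure R).
have /sigma_finiteP[G [TG ndG Goo]] := sigma_finiteT mu.
exists (fun k => @rV_uncons n @^-1` (F k `*` G k)).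
  rewrite -preimage_bigcup (_ : \bigcup_i _ = setT) ?preimage_setT//.
  apply/seteqP; split => // -[x v] _.
  have [i _ Fx] : (\bigcup_i F i) x by rewrite -TF.
  have [j _ Gv] : (\bigcup_i G i) v by rewrite -TG.
  exists (maxn i j) => //; split.
  - by move: x Fx; exact/subsetPset/ndF/leq_maxl.
  - by move: v Gv; exact/subsetPset/ndG/leq_maxr.
move=> k; have [mF Fk] := Foo k; have [mG Gk] := Goo k; split.
  by rewrite -[X in measurable X]setTI; apply: measurable_rV_uncons => //; exact: measurableX.
rewrite /rV_product /pushforward -comp_preimage (_ : _ \o _ = id); last first.
  by apply/funext => z /=; rewrite rV_consK.
by rewrite product_measure1E// lte_mul_pinfty// ge0_fin_numE.
Qed.

HB.instance Definition _ := Measure_isSigmaFinite.Build _ _ _ rV_product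
  rV_product_sigma_finite.

End rV_product.

(* Lebesgue measure on R^n, as an iterated product. *)
Fixpoint lebesgue_rV (n : nat) : {sigma_finite_measure set 'rV[R]_n -> \bar R} :=
  if n is m.+1 then rV_product (lebesgue_rV m) else \d_(0 : 'rV[R]_0).

Lemma measurable_rV_box (n : nat) (A : 'I_n -> set R) :
  (forall i, measurable (A i)) ->
  measurable [set x : 'rV[R]_n | forall i, A i (x ord0 i)].
Proof.
move=> mA; rewrite (_ : [set x | _] =
    \big[setI/setT]_(i < n) ((fun x : 'rV[R]_n => x ord0 i) @^-1` A i)).
  apply: bigsetI_measurable => i _.
  by rewrite -[X in measurable X]setTI; exact: measurable_coor.
apply/seteqP; split => x /=; rewrite -bigcap_seq /=.
  by move=> Ax i _; exact: Ax.
by move=> Ax i; apply: Ax; rewrite /= mem_index_enum.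
Qed.

(* This characterizes lebesgue_rV n as the n-dimensional Lebesgue measure. *)
Lemma lebesgue_rV_box (n : nat) (A : 'I_n -> set R) :
  (forall i, measurable (A i)) ->
  lebesgue_rV n [set x : 'rV[R]_n | forall i, A i (x ord0 i)]
    = (\prod_(i < n) lebesgue_measure (A i))%E.
Proof.
elim: n A => [|n IH] A mA.
  by rewrite big_ord0 /= diracE mem_set//= => -[].
rewrite big_ord_recl /= /rV_product /pushforward -IH//.
rewrite -product_measure1E; [|exact: (mA ord0)|]; last first.
  exact: (@measurable_rV_box n (fun i => A (lift ord0 i))).
congr product_measure1; apply/seteqP; split => -[a v] /=.
  move=> H; split; first by have := H ord0; rewrite mxE unlift_none.
  by move=> i; have := H (lift ord0 i); rewrite mxE liftK.
by move=> [Ha Hv] i; rewrite mxE; case: unliftP => [j ->|->] //=.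
Qed.

End lebesgue_rV.

(* Elements of L^2_C(Omega) are represented by functions 'rV[R]_n -> R[i] of
   which only the values on Omega matter; equality of classes is ae_eqO. *)
Section complex_L2.
Variables (R : realType) (n : nat) (Omega : set 'rV[R]_n).
Local Notation E := 'rV[R]_n.
Local Notation C := R[i].
Local Notation lebesgue := (lebesgue_rV R n).
Implicit Types (f g : E -> C) (v w : 'I_n -> E -> C).

Definition Cintegral f : C :=
  (\int[lebesgue]_(x in Omega) complex.Re (f x))%R +i*
  (\int[lebesgue]_(x in Omega) complex.Im (f x))%R.

Definition ae_eqO f g : Prop := {ae lebesgue, forall x, Omega x -> f x = g x}.

Definition L2 f : Prop :=
  [/\ measurable_fun Omega (fun x => complex.Re (f x)),
      measurable_fun Omega (fun x => complex.Im (f x)) &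
      lebesgue.-integrable Omega
        (fun x => (complex.Re (f x) ^+ 2 + complex.Im (f x) ^+ 2)%:E)].

Definition inner f g : C := Cintegral (fun x => (f x)^* * g x).

Definition norm2 f : R := Num.sqrt (complex.Re (inner f f)).

Definition L2n v : Prop := forall i, L2 (v i).

Definition innern v w : C := \sum_(i < n) inner (v i) (w i).

End complex_L2.

Section test_functions.
Variables (R : realType) (n : nat).
Local Notation E := 'rV[R]_n.
Local Notation C := R[i].

Definition partial (i : 'I_n) (f : E -> R) : E -> R :=
  fun x => 'D_(delta_mx ord0 i) f x.

Definition iter_partial (s : seq 'I_n) (f : E -> R) : E -> R :=
  foldr partial f s.

Definition smooth (f : E -> R) : Prop :=
  forall s : seq 'I_n, continuous (iter_partial s f) /\
    forall i x, derivable (iter_partial s f) x (delta_mx ord0 i).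

(* C_0^oo(Omega, C), each function being extended by 0 outside Omega. *)
Definition test_fun (Omega : set E) (phi : E -> C) : Prop :=
  [/\ smooth (fun x => complex.Re (phi x)),
      smooth (fun x => complex.Im (phi x)),
      compact (closure [set x | phi x != 0]) &
      closure [set x | phi x != 0] `<=` Omega].

Definition grad (phi : E -> C) : 'I_n -> E -> C := fun i x =>
  partial i (fun y => complex.Re (phi y)) x +i*
  partial i (fun y => complex.Im (phi y)) x.

End test_functions.

Section sobolev.
Variables (R : realType) (n : nat) (Omega : set 'rV[R]_n).
Local Notation E := 'rV[R]_n.
Local Notation C := R[i].
Implicit Types (u : E -> C) (g : 'I_n -> E -> C).

(* u is in W^1_C(Omega) and its weak gradient is g. *)
Definition W1 u g : Prop :=
  [/\ L2 Omega u, L2n Omega g &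
      forall phi, test_fun Omega phi -> forall i,
        Cintegral Omega (fun x => u x * grad phi i x) =
        - Cintegral Omega (fun x => g i x * phi x)].

Definition W1_norm u g : R :=
  Num.sqrt (norm2 Omega u ^+ 2 + \sum_(i < n) norm2 Omega (g i) ^+ 2).

(* u is in W^1_{0,C}(Omega), the closure of C_0^oo(Omega, C) in W^1_C(Omega),
   and its weak gradient is g; the weak gradient of a test function phi is
   grad phi, so the one of u - phi is g - grad phi. *)
Definition W1_0 u g : Prop :=
  W1 u g /\
  forall eps : R, 0 < eps -> exists2 phi, test_fun Omega phi &
    W1_norm (fun x => u x - phi x) (fun i x => g i x - grad phi i x) < eps.

End sobolev.

(* A linear operator in L^2_C(Omega), possibly unbounded, is given by its
   graph: A u f means that u is in D(A) and that A u = f. *)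
Section operators.
Variables (R : realType) (n : nat) (Omega : set 'rV[R]_n).
Local Notation E := 'rV[R]_n.
Local Notation C := R[i].
Implicit Types (A : (E -> C) -> (E -> C) -> Prop) (T : (E -> C) -> (E -> C)).

(* Graph of the adjoint of grad : C_0^oo(Omega, C) -> L^2_C(Omega)^n. The
   value w at v is unique because C_0^oo(Omega, C) is dense in L^2_C(Omega). *)
Definition grad_adj (v : 'I_n -> E -> C) (w : E -> C) : Prop :=
  [/\ L2n Omega v, L2 Omega w &
      forall phi, test_fun Omega phi ->
        innern Omega (grad phi) v = inner Omega phi w].

(* The real-valued coefficients bounded between two positive constants; they
   belong to L^oo(Omega) since they are measurable and essentially bounded. *)
Definition coef (p : E -> R) : Prop :=
  measurable_fun Omega p /\
  exists C1 C2 : R, [/\ 0 < C1, C1 <= C2 &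
    {ae lebesgue_rV R n, forall x, Omega x -> C1 <= p x <= C2}].

Definition diffusion (p : E -> R) (u w : E -> C) : Prop :=
  exists g, W1_0 Omega u g /\ grad_adj (fun i x => (1 / p x)%:C * g i x) w.

(* The order of R[i] is partial: z <= z' also says that z' - z is real. *)
Definition strictly_positive A : Prop :=
  exists2 c : R, 0 < c & forall u w, A u w ->
    (c * norm2 Omega u ^+ 2)%:C <= inner Omega u w.

(* A : D(A) -> L^2_C(Omega) is bijective, up to equality almost everywhere. *)
Definition bijective_op A : Prop :=
  forall f, L2 Omega f ->
    (exists u, A u f) /\
    (forall u u', A u f -> A u' f -> ae_eqO Omega u u').

(* A^-1 f, meaningful when A is bijective. *)
Definition op_inv A (f : E -> C) : E -> C := xget (fun=> 0) [set u | A u f].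

Definition bounded_linear_op T : Prop :=
  [/\ forall f, L2 Omega f -> L2 Omega (T f),
      forall (a : C) f g, L2 Omega f -> L2 Omega g ->
        ae_eqO Omega (T (fun x => a * f x + g x)) (fun x => a * T f x + T g x) &
      exists M : R, forall f, L2 Omega f ->
        norm2 Omega (T f) <= M * norm2 Omega f].

Definition bounded_self_adjoint T : Prop :=
  forall f g, L2 Omega f -> L2 Omega g ->
    inner Omega (T f) g = inner Omega f (T g).

Definition positive_op T : Prop :=
  forall f, L2 Omega f -> 0 <= inner Omega f (T f).

End operators.

(* Main.v *)
(* Let a_nu(g, h) = sum_i <g_i | (1/p_nu) h_i> be the form of A_nu.  Strict positivity
   of A_nu extends to a Poincare inequality |u|^2 <= K a_nu(grad u, grad u) on W^1_0,
   which makes A_nu bijective: a sequence of test functions that minimises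
   a_nu(grad u, grad u) - 2 Re <f | u> is Cauchy in W^1.  Put u_nu = A_nu^-1 f.  As p_nu
   decreases, a_nu increases; so, for nu <= xi and w = u_nu - u_xi,
     |w|^2 <= K a_0(grad w, grad w) <= K a_nu(grad w, grad w)
           <= K (<f | u_nu> - <f | u_xi>),
   with the constant K of p_0.  Hence the nonnegative sequence <f | u_nu> is
   nonincreasing, thus convergent, and (u_nu) is Cauchy in L^2; its limit is T f. *)
Require Import Defs.
From mathcomp Require Import all_boot all_order all_algebra.
From mathcomp Require Import complex.
From mathcomp Require Import all_classical all_reals all_analysis.
From mathcomp Require Import measurable_realfun ring lra.

Set Implicit Arguments.
Unset Strict Implicit.
Unset Printing Implicit Defensive.

Import Order.TTheory GRing.Theory Num.Theory.
Import numFieldNormedType.Exports.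

Local Open Scope classical_set_scope.
Local Open Scope ring_scope.
Local Open Scope complex_scope.

(** * Semi-inner products *)

(** Strict positivity is known on the domain of [A_nu] only. As the coefficients are merely
    measurable, the field (1/p) grad phi of a test function phi need not have a weak divergence in
    L^2, so phi need not lie in that domain and the Poincare inequality cannot be read off from the
    hypothesis. It is obtained from a shifted equation, which can be solved without strict
    positivity because the shift is coercive by itself. Classes of functions are never formed:
    functions are representatives, norms are seminorms and limits are chosen. Solutions are
    therefore built as limits of minimising sequences, and each property of T is inherited from the
    inverses by passing to the limit in norms and inner products. All forms are real parts. Nothing
    is lost, because test functions are stable under multiplication by ['i], which turns every
    imaginary part into a real part. *)

Lemma quadratic_ge0_discr (R : realType) (a b c : R) : 0 <= a -> 0 <= c ->
  (forall t, 0 <= a + 2 * t * b + t ^+ 2 * c) -> b ^+ 2 <= a * c.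
Proof.
move=> a0 c0 h; have [c_eq0|c_neq0] := eqVneq c 0.
  rewrite c_eq0 mulr0; have [->|b_neq0] := eqVneq b 0; first by rewrite expr0n.
  have := h (- (a + 1) / (2 * b)); rewrite c_eq0 mulr0 addr0.
  suff -> : a + 2 * (- (a + 1) / (2 * b)) * b = -1 by lra.
  by field.
have c_gt0 : 0 < c by rewrite lt_neqAle eq_sym c_neq0.
have := h (- b / c).
have -> : a + 2 * (- b / c) * b + (- b / c) ^+ 2 * c = a - b ^+ 2 / c by field.
by rewrite subr_ge0 ler_pdivrMr.
Qed.

Section semi_inner_product.
Variables (R : realType) (V : Type) (S : V -> Prop).
(** [comb u t v] stands for u + t v. No vector space structure is asked for, so that the same lemmas
    serve the representatives in [L2 Omega], where [B] is only semidefinite, and the test functions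
    with the form of the operator. *)
Variables (comb : V -> R -> V -> V) (B : V -> V -> R).
Hypothesis combS : forall u t v, S u -> S v -> S (comb u t v).
Hypothesis B_sym : forall u v, S u -> S v -> B u v = B v u.
Hypothesis B_combl : forall u t v w, S u -> S v -> S w ->
  B (comb u t v) w = B u w + t * B v w.
Hypothesis B_ge0 : forall u, S u -> 0 <= B u u.

Lemma semi_inner_sqr u t v : S u -> S v ->
  B (comb u t v) (comb u t v) = B u u + 2 * t * B u v + t ^+ 2 * B v v.
Proof.
move=> Su Sv; have Sc := combS t Su Sv.
rewrite B_combl// (B_sym Su Sc) (B_sym Sv Sc) !B_combl// (B_sym Sv Su).
by ring.
Qed.

Lemma semi_inner_CauchySchwarz u v : S u -> S v -> B u v ^+ 2 <= B u u * B v v.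
Proof.
move=> Su Sv; apply: quadratic_ge0_discr; rewrite ?B_ge0// => t.
by rewrite -semi_inner_sqr// B_ge0//; exact: combS.
Qed.

Lemma semi_inner_triangle u t v : S u -> S v ->
  Num.sqrt (B (comb u t v) (comb u t v)) <=
  Num.sqrt (B u u) + `|t| * Num.sqrt (B v v).
Proof.
move=> Su Sv; rewrite -sqrtr_sqr -sqrtrM ?sqr_ge0//.
set x := B u u; set y := t ^+ 2 * B v v.
have x0 : 0 <= x by exact: B_ge0.
have y0 : 0 <= y by rewrite mulr_ge0 ?sqr_ge0 ?B_ge0.
rewrite -(ler_pXn2r (ltn0Sn 1)) ?nnegrE ?addr_ge0 ?sqrtr_ge0//.
rewrite sqrrD !sqr_sqrtr// ?B_ge0//; last exact: combS.
rewrite semi_inner_sqr// -/x -/y lerD2r lerD2l -[leRHS]mulr_natl -mulrA ler_pM2l//.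
rewrite -sqrtrM// (le_trans (ler_norm _))// -sqrtr_sqr ler_sqrt; last first.
  exact: mulr_ge0.
rewrite exprMn /y [leRHS]mulrCA ler_wpM2l ?sqr_ge0//; exact: semi_inner_CauchySchwarz.
Qed.

(* A minimising sequence for [B v v - 2 l v] solves [B u . = l] in the limit, with
   an error bounded by the norm of the argument: taking [u k - u m] as argument
   makes the sequence Cauchy. *)
Lemma minimizing_sequence (l : V -> R) (K : R) :
  (exists u, S u) ->
  (forall u t v, S u -> S v -> l (comb u t v) = l u + t * l v) ->
  (forall v, S v -> l v ^+ 2 <= K * B v v) ->
  exists u : nat -> V, [/\ forall k, S (u k),
    forall k v, S v -> (B (u k) v - l v) ^+ 2 <= k.+1%:R^-1 * B v v &
    forall k m, Num.sqrt (B (comb (u k) (-1) (u m)) (comb (u k) (-1) (u m))) <=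
      Num.sqrt k.+1%:R^-1 + Num.sqrt m.+1%:R^-1].
Proof.
move=> [u0 Su0] l_comb l_bnd.
pose J v := B v v - 2 * l v.
have J_ge v : S v -> - `|K| <= J v.
  move=> Sv; have Bv := B_ge0 Sv; have lv := l_bnd _ Sv.
  have : K * B v v <= `|K| * B v v by rewrite ler_wpM2r// ler_norm.
  rewrite /J; have := normr_ge0 K; move: (B v v) (l v) (`|K|) Bv lv => b m k b0 mk k0 kb.
  (* The claim amounts to 2 m <= b + k. Otherwise 4 m^2 > (b + k)^2 >= 4 k b, against the bound on
     m^2. *)
  have [le_mb|lt_bm] := leP (2 * m) (b + k); first by lra.
  have : 0 < (2 * m - (b + k)) * (2 * m + (b + k)) by apply: mulr_gt0; lra.
  have := sqr_ge0 (b - k); nra.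
pose E := [set J v | v in [set v | S v]].
have infE : has_inf E.
  split; first by exists (J u0), u0.
  by exists (- `|K|) => _ [v Sv <-]; exact: J_ge.
have /choice[u Hu] : forall k : nat, exists v, S v /\ J v < inf E + k.+1%:R^-1.
  move=> k.
  have [_ [v Sv <-] Jv] : exists2 y, E y & y < inf E + k.+1%:R^-1.
    by apply: inf_adherent => //; rewrite invr_gt0.
  by exists v.
(* [u k] minimises [J] up to 1/(k+1), so moving it by t v cannot lower [J] by more than that. This
   is a quadratic inequality in t, and its discriminant gives the estimate. *)
have est k v : S v -> (B (u k) v - l v) ^+ 2 <= k.+1%:R^-1 * B v v.
  have [Su Ju] := Hu k; move=> Sv; apply: quadratic_ge0_discr.
  - by rewrite invr_ge0.
  - exact: B_ge0.
  move=> t; have : inf E <= J (comb (u k) t v).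
    apply: ge_inf; first by case: infE.
    by exists (comb (u k) t v) => //; exact: combS.
  rewrite {1}/J semi_inner_sqr// l_comb//; move: Ju; rewrite /J.
  move: (B (u k) (u k)) (B (u k) v) (B v v) (l (u k)) (l v) (inf E) (k.+1%:R^-1).
  move=> x1 x2 x3 x4 x5 x6 x7; lra.
exists u; split => // [k|k m]; first by case: (Hu k).
have [Sk _] := Hu k; have [Sm _] := Hu m.
set w := comb _ _ _; have Sw : S w by exact: combS.
set s := Num.sqrt _.
have s0 : 0 <= s by rewrite sqrtr_ge0.
have dev i : `|B (u i) w - l w| <= Num.sqrt i.+1%:R^-1 * s.
  rewrite -sqrtr_sqr -sqrtrM ?invr_ge0// ler_sqrt ?est//.
  by rewrite mulr_ge0 ?B_ge0 ?invr_ge0.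
have ss : s ^+ 2 <= (Num.sqrt k.+1%:R^-1 + Num.sqrt m.+1%:R^-1) * s.
  rewrite sqr_sqrtr ?B_ge0// {1}/w B_combl// mulN1r mulrDl.
  have -> : B (u k) w - B (u m) w = (B (u k) w - l w) - (B (u m) w - l w) by ring.
  by rewrite (le_trans (ler_norm _))// (le_trans (ler_normB _ _))// lerD.
have [->|s_neq0] := eqVneq s 0; first by rewrite addr_ge0 ?sqrtr_ge0.
by rewrite -(ler_pM2r (_ : 0 < s)) ?lt_neqAle 1?eq_sym ?s_neq0// -expr2.
Qed.

End semi_inner_product.

(** * Square-integrable functions *)

Section square_integrable.
Context d (T : measurableType d) (R : realType).
Variables (mu : {measure set T -> \bar R}) (D : set T).
Hypothesis mD : measurable D.
Implicit Types f g : T -> R.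

Definition sqint f : Prop :=
  measurable_fun D f /\ mu.-integrable D (fun x => (f x ^+ 2)%:E).

Lemma norm_le_integrable f g : measurable_fun D f ->
  (forall x, D x -> `|f x| <= g x) ->
  mu.-integrable D (EFin \o g) -> mu.-integrable D (EFin \o f).
Proof.
move=> mf fg ig; apply: le_integrable ig => //.
  exact/measurable_EFinP.
by move=> x Dx /=; rewrite lee_fin (le_trans (fg x Dx))// ler_norm.
Qed.

Lemma integrableZl_EFin f t : mu.-integrable D (fun x => (f x)%:E) ->
  mu.-integrable D (fun x => (t * f x)%:E).
Proof. by move=> /(integrableZl mD t); apply: eq_integrable. Qed.

Lemma ae_le_Rintegral f g : mu.-integrable D (EFin \o f) ->
  mu.-integrable D (EFin \o g) -> {ae mu, forall x, D x -> f x <= g x} ->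
  \int[mu]_(x in D) f x <= \int[mu]_(x in D) g x.
Proof.
move=> If Ig fg; rewrite -subr_ge0 -RintegralB//.
have Igf := integrableB mD Ig If.
(* The difference is nonnegative only almost everywhere; its absolute value is so at every point. *)
rewrite /Rintegral (ae_eq_integral (fun x => `|g x - f x|%:E)).
- by apply: Rintegral_ge0.
- exact: mD.
- exact: measurable_int Igf.
- have /measurable_EFinP mgf : measurable_fun D (EFin \o (fun x => g x - f x)).
    exact: measurable_int Igf.
  by apply/measurable_EFinP; apply: measurableT_comp.
- by apply: filterS fg => x + Dx => /(_ Dx) fgx; rewrite ger0_norm// subr_ge0.
Qed.

Lemma sqint_mul f g : sqint f -> sqint g ->
  mu.-integrable D (fun x => (f x * g x)%:E).
Proof.
move=> [mf if2] [mg ig2].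
apply: (@norm_le_integrable _ (fun x => f x ^+ 2 + g x ^+ 2)).
- exact: measurable_funM.
- move=> x _; rewrite ler_norml; apply/andP; split.
    by have := sqr_ge0 (f x + g x); have := sqr_ge0 (f x); have := sqr_ge0 (g x); nra.
  by have := sqr_ge0 (f x - g x); have := sqr_ge0 (f x); have := sqr_ge0 (g x); nra.
- by have := integrableD mD if2 ig2; apply: eq_integrable.
Qed.

Lemma sqint_lin f g t : sqint f -> sqint g -> sqint (fun x => f x + t * g x).
Proof.
move=> sf sg; have [mf if2] := sf; have [mg ig2] := sg.
have m : measurable_fun D (fun x => f x + t * g x).
  by apply: measurable_funD => //; apply: measurable_funM.
split=> //; have ifg := sqint_mul sf sg.
have := integrableD mD if2 (integrableD mD (integrableZl mD (2 * t) ifg)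
  (integrableZl mD (t ^+ 2) ig2)).
by apply: eq_integrable => // x _ /=; rewrite -!EFinM -!EFinD; congr EFin; ring.
Qed.

Lemma sqint_bounded_mul f (b : T -> R) M : measurable_fun D b -> 0 <= M ->
  {ae mu, forall x, D x -> `|b x| <= M} -> sqint f -> sqint (fun x => b x * f x).
Proof.
move=> mb M0 bM [mf if2].
have m : measurable_fun D (fun x => b x * f x) by exact: measurable_funM.
split=> //; apply/integrableP; split.
  by apply/measurable_EFinP; exact: measurable_funX.
have /integrableP[_] := integrableZl mD (M ^+ 2) if2.
apply: le_lt_trans; apply: ae_ge0_le_integral => //.
- by apply: measurableT_comp => //; apply/measurable_EFinP; exact: measurable_funX.
- apply: measurableT_comp => //; apply/measurable_EFinP.
  by apply: measurable_funM => //; exact: measurable_funX.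
- apply: filterS bM => x + Dx => /(_ Dx) bM.
  rewrite /= lee_fin (ger0_norm (sqr_ge0 _)) normrM !(ger0_norm (sqr_ge0 _)).
  rewrite exprMn ler_wpM2r ?sqr_ge0// -real_normK ?num_real//.
  by rewrite lerXn2r ?nnegrE.
Qed.

Definition ip f g : R := \int[mu]_(x in D) (f x * g x).

Lemma ip_sym f g : ip f g = ip g f.
Proof. by apply: eq_Rintegral => x _; rewrite mulrC. Qed.

Lemma ip_linl f g h t : sqint f -> sqint g -> sqint h ->
  ip (fun x => f x + t * g x) h = ip f h + t * ip g h.
Proof.
move=> sf sg sh; have ifh := sqint_mul sf sh; have igh := sqint_mul sg sh.
rewrite /ip -RintegralZl// -RintegralD//; last exact: integrableZl_EFin.
by apply: eq_Rintegral => x _; rewrite mulrDl mulrA.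
Qed.

Lemma ip_ge0 f : 0 <= ip f f.
Proof. by apply: Rintegral_ge0 => x _; rewrite -expr2 sqr_ge0. Qed.

Lemma EFin_ip f g : sqint f -> sqint g ->
  (ip f g)%:E = (\int[mu]_(x in D) (f x * g x)%:E)%E.
Proof. by move=> sf sg; rewrite fineK// integrable_fin_num//; exact: sqint_mul. Qed.

Lemma ip_eq0 f : sqint f -> ip f f = 0 -> {ae mu, forall x, D x -> f x = 0}.
Proof.
move=> sf f0; have [mf _] := sf.
have m : measurable_fun D (fun x => (f x * f x)%:E).
  by apply/measurable_EFinP; exact: measurable_funM.
have /(ae_eq_integral_abs _ mD m) : (\int[mu]_(x in D) `|(f x * f x)%:E| = 0)%E.
  under eq_integral do rewrite gee0_abs ?lee_fin -?expr2 ?sqr_ge0//.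
  by under eq_integral do rewrite expr2; rewrite -EFin_ip// f0.
apply: filterS => x + Dx => /(_ Dx) /= [] /eqP.
by rewrite mulf_eq0 orbb => /eqP.
Qed.

Lemma le_ip_weight (b c : T -> R) f : sqint f -> sqint (fun x => b x * f x) ->
  sqint (fun x => c x * f x) -> {ae mu, forall x, D x -> b x <= c x} ->
  ip f (fun x => b x * f x) <= ip f (fun x => c x * f x).
Proof.
move=> sf sbf scf bc; apply: ae_le_Rintegral; [exact: sqint_mul|exact: sqint_mul|].
apply: filterS bc => x + Dx => /(_ Dx) bcx.
by rewrite mulrCA [leRHS]mulrCA ler_wpM2r// -expr2 sqr_ge0.
Qed.

Lemma ip_weight_bound (b : T -> R) M f : 0 <= M ->
  {ae mu, forall x, D x -> `|b x| <= M} -> sqint f -> sqint (fun x => b x * f x) ->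
  ip (fun x => b x * f x) (fun x => b x * f x) <= M ^+ 2 * ip f f.
Proof.
move=> M0 bM sf sbf; rewrite /ip -RintegralZl//; last exact: sqint_mul.
apply: ae_le_Rintegral; [exact: sqint_mul|exact: integrableZl_EFin (sqint_mul sf sf)|].
apply: filterS bM => x + Dx => /(_ Dx) bMx.
rewrite -!expr2 exprMn ler_wpM2r ?sqr_ge0// -real_normK ?num_real//.
by rewrite lerXn2r ?nnegrE.
Qed.

Definition sqdist f g := ip (fun x => f x - g x) (fun x => f x - g x).

Lemma sqintB f g : sqint f -> sqint g -> sqint (fun x => f x - g x).
Proof.
move=> sf sg; rewrite (_ : (fun x => _) = (fun x => f x + (-1) * g x)).
  exact: sqint_lin.
by apply/funext => x; rewrite mulN1r.
Qed.

End square_integrable.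

(** * Completeness of L^2 *)

Section Riesz_Fischer.
Context d (T : measurableType d) (R : realType).
Variables (mu : {measure set T -> \bar R}) (D : set T).
Hypothesis mD : measurable D.

(** The weights 2^i make the increments absolutely summable. Squares are used rather than absolute
    values because integrating them over the points of the domain gives L^2 distances, which the
    Cauchy property controls. *)
Lemma cvg_fast_sqr_increments (u : nat -> R) (M : R) :
  (forall n, \sum_(0 <= i < n) 2 ^+ i * (u i.+1 - u i) ^+ 2 <= M) -> cvgn u.
Proof.
move=> uM; have hser : cvgn (series (telescope u)).
  apply: normed_cvg; apply: nondecreasing_is_cvgn.
    by apply: nondecreasing_series => i _ _; exact: normr_ge0.
  exists (2 + M) => _ [n _ <-] /=.
  have geo : \sum_(0 <= i < n) (2 : R) ^- i <= 2.
    suff -> : \sum_(0 <= i < n) (2 : R) ^- i = 2 - 2 * 2 ^- n.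
      by rewrite gerBl mulr_ge0// invr_ge0 exprn_ge0.
    elim: n => [|n IH]; first by rewrite big_geq// expr0 invr1 mulr1 subrr.
    by rewrite big_nat_recr//= IH exprS invfM; field; rewrite expf_neq0.
  (* AM-GM: [|z| <= 2^-i + 2^i z^2] *)
  apply: le_trans (lerD geo (uM n)); rewrite -big_split /=.
  apply: ler_sum => i _; rewrite /telescope.
  set z := u i.+1 - u i; have e0 : 0 < (2 : R) ^+ i by rewrite exprn_gt0.
  rewrite -(ler_pM2l e0) mulrDr divff ?gt_eqF//.
  rewrite -[z ^+ 2]real_normK ?num_real//.
  by have := sqr_ge0 (2 ^+ i * `|z| - 1); nra.
have -> : u = (fun n => u 0 + series (telescope u) n).
  by apply/funext => n; rewrite telescopeK addrC subrK.
by apply: is_cvgD => //; exact: is_cvg_cst.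
Qed.

(* Riesz-Fischer: a subsequence with fast decreasing increments converges almost
   everywhere, and Fatou's lemma transfers the Cauchy estimate to its limit. *)
Lemma sqint_complete (f : nat -> T -> R) : (forall k, sqint mu D (f k)) ->
  (forall e, 0 < e -> exists N, forall j k, (N <= j)%N -> (N <= k)%N ->
    sqdist mu D (f j) (f k) <= e) ->
  exists2 g, sqint mu D g & forall e, 0 < e -> exists N, forall k, (N <= k)%N ->
    sqdist mu D (f k) g <= e.
Proof.
move=> sf cf.
have mf k : measurable_fun D (f k) by case: (sf k).
(* This bound makes the integral of [q i] below at most 2^-(i+1), so that the sum [G] of the [q i]
   is integrable. *)
pose w i : R := (2 ^+ i)^-1 * (1 / (2 ^ (i + 1))%:R).
have /choice[N HN] : forall i : nat, exists N, forall j k, (N <= j)%N -> (N <= k)%N ->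
    sqdist mu D (f j) (f k) <= w i.
  by move=> i; apply: cf; rewrite mulr_gt0// ?invr_gt0 ?exprn_gt0// divr_gt0// ltr0n expn_gt0.
(* Adding up the [(N l).+1] yields an index that is at least [N i], grows with i, and is at least i
   itself. *)
pose s i := (\sum_(0 <= l < i.+1) (N l).+1)%N.
have sN i : (N i <= s i)%N.
  by rewrite /s big_nat_recr//= (leq_trans (leqnSn _))// leq_addl.
have sS i : (s i <= s i.+1)%N by rewrite /s [leqRHS]big_nat_recr//= leq_addr.
have s_ge i : (i <= s i)%N.
  elim: i => // i IH; rewrite /s big_nat_recr//= -/(s i) addnS ltnS.
  by rewrite (leq_trans IH)// leq_addr.
pose q i x : R := 2 ^+ i * (f (s i.+1) x - f (s i) x) ^+ 2.
have q0 i x : (0%R <= (q i x)%:E)%E.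
  by rewrite lee_fin; apply: mulr_ge0; [exact: exprn_ge0|exact: sqr_ge0].
have mq i : measurable_fun D (fun x => (q i x)%:E).
  apply/measurable_EFinP; apply: measurable_funM => //.
  by apply: measurable_funX; exact: measurable_funB.
pose G x := (\sum_(0 <= i <oo) (q i x)%:E)%E.
have G0 x : (0%R <= G x)%E by apply: nneseries_ge0.
have mG : measurable_fun D G.
  by apply: (@ge0_emeasurable_sum _ _ _ _ (fun i x => (q i x)%:E) xpredT).
have iG : mu.-integrable D G.
  apply/integrableP; split=> //; under eq_integral do rewrite gee0_abs//.
  rewrite integral_nneseries//.
  apply: (@le_lt_trans _ _ (\sum_(0 <= i <oo) (1 / (2 ^ (i + 1))%:R)%:E)%E); last first.
    suff -> : (\sum_(0 <= i <oo) (1 / (2 ^ (i + 1))%:R)%:E)%E = (1 / 2 ^+ 0 : R)%:E.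
      exact: ltry.
    by apply/cvg_lim => //; exact: cvg_geometric_eseries_half.
  apply: lee_nneseries => [i _ _|i _]; first exact: integral_ge0.
  have s2 := sqintB mD (sf (s i.+1)) (sf (s i)).
  rewrite /q; under eq_integral do rewrite EFinM.
  rewrite integralZl//; last by case: s2.
  under eq_integral do rewrite expr2.
  rewrite -EFin_ip// -EFinM lee_fin -ler_pdivlMl ?exprn_gt0//.
  by apply: HN; rewrite ?(leq_trans (sN i)).
(* [G] is finite almost everywhere on [D]. Putting the functions to 0 outside [P] makes them
   converge at every point, so that the limit is measurable. *)
pose P := D `&` [set x | G x \is a fin_num].
have mP : measurable P by exact: emeasurable_fin_num.
pose h i := f (s i) \_ P.
have mh i : measurable_fun D (h i).
  by apply/measurable_restrict => //; exact: measurable_funS (mf _).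
have ch x : cvgn (h ^~ x).
  have [Px|Px] := boolP (x \in P); last first.
    rewrite (_ : h ^~ x = cst 0); first exact: is_cvg_cst.
    by apply/funext => i; rewrite /h patchE (negbTE Px).
  have [Dx Gx] := set_mem Px.
  have -> : h ^~ x = fun i => f (s i) x.
    by apply/funext => i; rewrite /h patchE Px.
  apply: (@cvg_fast_sqr_increments _ (fine (G x))) => n.
  rewrite -lee_fin fineK// -sumEFin.
  exact: (@nneseries_lim_ge _ (fun i => (q i x)%:E) xpredT 0%N n).
pose g x := limn (h ^~ x).
have hg x : h ^~ x @ \oo --> g x by exact: ch.
have mg : measurable_fun D g by apply: measurable_fun_cvg mh _ => x _.
have key e : 0 < e -> exists K, forall k, (K <= k)%N ->
    (\int[mu]_(x in D) ((f k x - g x) ^+ 2)%:E <= e%:E)%E.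
  move=> /cf[K HK]; exists K => k Kk.
  have mfh i : measurable_fun D (fun x => ((f k x - h i x) ^+ 2)%:E).
    by apply/measurable_EFinP; apply: measurable_funX; exact: measurable_funB.
  have := fatou mu mD mfh (fun i x _ => ltac:(by rewrite lee_fin sqr_ge0)).
  under eq_integral => x _.
    rewrite (cvg_limn_einf_sup (l := ((f k x - g x) ^+ 2)%:E)); last first.
      apply: cvg_EFin; first exact: nearW.
      rewrite expr2; under eq_fun do rewrite /= expr2.
      by apply: cvgM; apply: cvgB => //; exact: cvg_cst.
    over.
  move/le_trans; apply; rewrite limn_einf_lim; apply: lime_le.
    exact: is_cvg_einfs.
  exists K => // i /= Ki.
  apply: (@le_trans _ _ (\int[mu]_(x in D) ((f k x - h i x) ^+ 2)%:E)%E).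
    by apply: ereal_inf_lbound; exists i => //=.
  rewrite (@ge0_ae_eq_integral _ _ _ mu D _ (fun x => ((f k x - f (s i) x) ^+ 2)%:E))//.
  - under eq_integral do rewrite expr2.
    rewrite -EFin_ip; [|exact: mD|exact: sqintB|exact: sqintB].
    by rewrite lee_fin; apply: HK => //; exact: leq_trans (s_ge i).
  - by apply/measurable_EFinP; apply: measurable_funX; exact: measurable_funB.
  - by move=> x _; rewrite lee_fin sqr_ge0.
  - by move=> x _; rewrite lee_fin sqr_ge0.
  - apply: filterS (integrable_ae mD iG) => x Gx Dx.
    by rewrite /h patchE mem_set//; split=> //; exact: Gx.
have sfg k : (\int[mu]_(x in D) ((f k x - g x) ^+ 2)%:E < +oo)%E ->
    sqint mu D (fun x => f k x - g x).
  move=> fin; split; first exact: measurable_funB.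
  apply/integrableP; split.
    by apply/measurable_EFinP; apply: measurable_funX; exact: measurable_funB.
  by under eq_integral do rewrite gee0_abs ?lee_fin ?sqr_ge0//.
have sg : sqint mu D g.
  have [K /(_ K (leqnn _)) H] := key 1 ltr01.
  have := sqintB mD (sf K) (sfg K (le_lt_trans H (ltry _))).
  by under eq_fun do rewrite opprB addrC subrK.
exists g => // e /key[K HK]; exists K => k Kk.
rewrite -lee_fin EFin_ip; [|exact: mD|exact: sqintB|exact: sqintB].
by under eq_integral do rewrite -expr2; exact: HK.
Qed.

End Riesz_Fischer.

(** * Integration by parts for the Lebesgue measure of row vectors *)

Section Borel_rV.
Variables (R : realType) (n : nat).
Local Notation E := 'rV[R]_n.

(** The sigma-algebra is generated by the coordinates, not by the topology. An open set is the union
    of the boxes with rational corners that it contains, and there are countably many of them. *)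
Lemma measurable_open_rV (U : set E) : open U -> measurable U.
Proof.
move=> oU.
pose box (ab : 'rV[rat]_n * 'rV[rat]_n) := [set x : E | forall i,
  `]ratr (ab.1 ord0 i), ratr (ab.2 ord0 i)[%classic (x ord0 i)].
have mbox ab : measurable (box ab).
  by apply: (@measurable_rV_box R n (fun i => _)) => i; exact: measurable_itv.
have -> : U = \bigcup_ab (if `[< box ab `<=` U >] then box ab else set0).
  apply/seteqP; split=> [x Ux|x [ab _]]; last first.
    by case: asboolP => [sub|_]; [exact: sub|].
  have [e /= e0 xeU] : nbhs_ball x U by apply/nbhs_ballP; exact: open_nbhs_nbhs.
  have /choice[a Ha] : forall i, exists q : rat, ratr q \in `]x ord0 i - e, x ord0 i[.
    by move=> i; apply: rat_in_itvoo; rewrite ltrBlDr ltrDl.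
  have /choice[b Hb] : forall i, exists q : rat, ratr q \in `]x ord0 i, x ord0 i + e[.
    by move=> i; apply: rat_in_itvoo; rewrite ltrDl.
  exists (\row_i a i, \row_i b i) => //; rewrite asboolT.
    move=> i; rewrite /= in_itv/= !mxE.
    by move: (Ha i) (Hb i); rewrite !in_itv/= => /andP[_ ->] /andP[->].
  move=> y yab; apply: xeU; split=> // i j; rewrite (ord1 i).
  move: (yab j) (Ha j) (Hb j); rewrite /= !in_itv/= !mxE /ball/= ltr_distlC.
  move=> /andP[ay yb] /andP[xa _] /andP[_ bx].
  by rewrite (lt_trans xa ay) (lt_trans yb bx).
apply: countable_bigcupT_measurable => [|ab]; first exact: countableP.
by case: ifP.
Qed.

Lemma continuous_measurable_rV (f : E -> R) :
  continuous f -> measurable_fun [set: E] f.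
Proof.
move=> /continuousP cf; apply: (measurability _ (RGenOpens.measurableE R)).
move=> _ [_ [a [b ->] <-]]; rewrite setTI; apply: measurable_open_rV.
exact/cf/interval_open.
Qed.

Definition cube (M : R) := [set x : E | forall i, `[(- M), M]%classic (x ord0 i)].

Lemma measurable_cube M : measurable (cube M).
Proof. exact: (@measurable_rV_box R n (fun=> `[(- M), M]%classic)). Qed.

Lemma compact_cube M : compact (cube M).
Proof.
exact: (@rV_compact R n (fun=> `[(- M), M]%classic) (fun=> @segment_compact _ _ _)).
Qed.

Lemma lebesgue_rV_cube_lty M : (lebesgue_rV R n (cube M) < +oo)%E.
Proof.
rewrite /cube (lebesgue_rV_box (A := fun=> `[- M, M]%classic)); last by [].
rewrite ltey_eq prode_fin_num// => i _; rewrite lebesgue_measure_itv /=.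
by case: ifP.
Qed.

Lemma cubeP M (x : E) : reflect (exists i, M < `|x ord0 i|) (x \notin cube M).
Proof.
apply: (iffP idP) => [|[i Mx]].
  rewrite notin_setE => /existsNP[i Hi]; exists i.
  by rewrite ltNge ler_norml; apply/negP; apply: contra_not Hi; rewrite /= in_itv.
rewrite notin_setE => /(_ i); rewrite /= in_itv /= -ler_norml.
by move/(lt_le_trans Mx); rewrite ltxx.
Qed.

(** A substitute for compact support that passes to slices with the same [M], as the induction on
    the dimension requires. *)
Definition cube_supported M (f : E -> R) := forall x, x \notin cube M -> f x = 0.

Lemma cube_supported_bounded M f : continuous f -> cube_supported M f ->
  exists K, forall x, `|f x| <= K.
Proof.
move=> cf sf; have : compact (f @` cube M).
  apply: continuous_compact; last exact: compact_cube.
  exact: continuous_subspaceT.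
move/compact_bounded => [K [_ HK]]; exists (`|K| + 1) => x.
have [xM|xM] := boolP (x \in cube M); last by rewrite sf// normr0 addr_ge0.
apply: HK; first by rewrite (le_lt_trans (ler_norm _))// ltrDl.
by exists x => //; exact/set_mem.
Qed.

Lemma cube_supported_integrable M f : continuous f -> cube_supported M f ->
  (lebesgue_rV R n).-integrable setT (EFin \o f).
Proof.
move=> cf sf; have [K fK] := cube_supported_bounded cf sf.
have -> : EFin \o f = (EFin \o f) \_ (cube M).
  by apply/funext => x; rewrite patchE; case: ifPn => //= /sf ->.
rewrite -integrable_mkcond; last exact: measurable_cube.
apply: measurable_bounded_integrable.
- exact: measurable_cube.
- exact: lebesgue_rV_cube_lty.
- by apply: measurable_funTS; exact: continuous_measurable_rV.
- by exists K; split; rewrite ?num_real// => L KL x _; exact: le_trans (fK x) (ltW KL).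
Qed.

End Borel_rV.

(** * Slices of functions and vanishing integrals of partial derivatives *)

Section integration_by_parts.
Variable R : realType.

Lemma continuous_rV_cons_r n (a : R) : continuous (fun v : 'rV[R]_n => rV_cons (a, v)).
Proof.
move=> v A [P HP PA]; exists (fun i j => P i (lift ord0 j)).
  by move=> i j; have := HP i (lift ord0 j); rewrite (ord1 i) !mxE liftK.
move=> w Pw; apply: PA => i j; rewrite mxE; case: unliftP => [k ->|->] /=.
  by have := Pw i k; rewrite (ord1 i).
by have := HP i ord0; rewrite mxE unlift_none => /nbhs_singleton.
Qed.

Lemma continuous_rV_cons_l n (v : 'rV[R]_n) : continuous (fun a : R => rV_cons (a, v)).
Proof.
move=> a A [P HP PA]; have := HP ord0 ord0; rewrite mxE unlift_none /=.
apply: filterS => b Pb; apply: PA => i j; rewrite (ord1 i) mxE.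
case: unliftP => [k ->|->] //=.
by have := HP ord0 (lift ord0 k); rewrite mxE liftK => /nbhs_singleton.
Qed.

Lemma rV_cons_shift_lift n (h a : R) (v : 'rV[R]_n) j :
  h *: delta_mx ord0 (lift ord0 j) + rV_cons (a, v) =
  rV_cons (a, h *: delta_mx ord0 j + v).
Proof.
apply/rowP => k; rewrite !mxE eqxx /=; case: unliftP => [l ->|->] /=.
  by rewrite !mxE eqxx /= (inj_eq (@lift_inj _ _)).
by rewrite mulr0 add0r.
Qed.

Lemma rV_cons_shift0 n (h a : R) (v : 'rV[R]_n) :
  h *: delta_mx ord0 ord0 + rV_cons (a, v) = rV_cons (h *: (1 : R) + a, v).
Proof.
apply/rowP => k; rewrite !mxE eqxx /=; case: unliftP => [l ->|->] /=.
  by rewrite mulr0 add0r.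
by [].
Qed.

(** The two difference quotients are the same function of h, although [F] and [G] live on different
    spaces. This identifies a partial derivative with the derivative of a slice. *)
Lemma derive_congr (V W : normedModType R) (F : V -> R) (G : W -> R) x v y w :
  (forall h, F (h *: v + x) = G (h *: w + y)) ->
  (derivable F x v = derivable G y w) * ('D_v F x = 'D_w G y).
Proof.
move=> FG; have quotE : (fun h : R => h^-1 *: ((F \o shift x) (h *: v) - F x)) =
    (fun h => h^-1 *: ((G \o shift y) (h *: w) - G y)).
  by apply/funext => h /=; rewrite FG; have := FG 0; rewrite !scale0r !add0r => ->.
by split; rewrite /derivable /derive quotE.
Qed.

Lemma cube_supported_cons_r n M (F : 'rV[R]_n.+1 -> R) a :
  cube_supported M F -> cube_supported M (fun v => F (rV_cons (a, v))).
Proof.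
move=> sF v /cubeP[i vi]; apply: sF; apply/cubeP; exists (lift ord0 i).
by rewrite mxE liftK.
Qed.

Lemma cube_supported_cons_l n M (F : 'rV[R]_n.+1 -> R) a v :
  cube_supported M F -> M < `|a| -> F (rV_cons (a, v)) = 0.
Proof.
by move=> sF va; apply: sF; apply/cubeP; exists ord0; rewrite mxE unlift_none.
Qed.

Lemma integral_derive_supported (phi dphi : R -> R) (M : R) :
  (forall a, derivable phi a 1) -> (forall a, 'D_1 phi a = dphi a) ->
  continuous dphi -> (forall a, M < `|a| -> phi a = 0) ->
  (forall a, M < `|a| -> dphi a = 0) ->
  (\int[lebesgue_measure]_a (dphi a)%:E = 0)%E.
Proof.
(* [K] is positive and strictly larger than [M], whatever the sign of [M], so [phi] vanishes at both
   end points -K and K. *)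
move=> dp dpE cd p0 d0; set K := `|M| + 1.
have MK : M < K by rewrite (le_lt_trans (ler_norm _))// ltrDl.
have K0 : 0 < K by rewrite ltr_pwDr.
have -> : (\int[lebesgue_measure]_a (dphi a)%:E)%E =
    (\int[lebesgue_measure]_(a in `[(- K)%R, K]) (dphi a)%:E)%E.
  rewrite [RHS]integral_mkcond; apply: eq_integral => a _.
  rewrite patchE; case: ifPn => // aK; rewrite d0//; apply: (lt_trans MK).
  rewrite ltNge ler_norml; apply/negP => aK'.
  by move: aK; rewrite notin_setE /= in_itv /=; exact.
have cphi : continuous phi.
  by move=> a; apply: differentiable_continuous; apply/derivable1_diffP; exact: dp.
rewrite (@continuous_FTC2 R dphi phi).
- by rewrite !p0 ?normrN ?(gtr0_norm K0)// subee.
- by rewrite gtrN.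
- exact: continuous_subspaceT.
- split=> [a _|//|//]; first exact: dp.
    by apply: cvg_at_right_filter; exact: cphi.
  by apply: cvg_at_left_filter; exact: cphi.
- by move=> a _; rewrite derive1E dpE.
Qed.

(* Fubini and induction on the dimension reduce this to the fundamental theorem of
   calculus in the first variable. *)
Lemma integral_partial n (i : 'I_n) (F : 'rV[R]_n -> R) M :
  (forall x, derivable F x (delta_mx ord0 i)) -> continuous (partial i F) ->
  cube_supported M F -> cube_supported M (partial i F) ->
  (\int[lebesgue_rV R n]_x (partial i F x)%:E = 0)%E.
Proof.
elim: n i F => [|n IH] i F dF cF sF spF; first by case: i dF cF spF.
have mp : measurable_fun setT (fun x => (partial i F x)%:E).
  by apply/measurable_EFinP; exact: continuous_measurable_rV.
have ip := cube_supported_integrable cF spF.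
have ipc : (lebesgue_measure \x lebesgue_rV R n)%E.-integrable setT
    (fun z => (partial i F (rV_cons z))%:E).
  apply/integrableP; split.
    apply: (measurableT_comp mp); exact: measurable_rV_cons.
  have /integrableP[_] := ip; rewrite ge0_integral_pushforward//.
    exact: measurable_rV_cons.
  by apply: measurableT_comp.
rewrite /= /rV_product integral_pushforward//; last exact: measurable_rV_cons.
rewrite preimage_setT /=; case: (unliftP ord0 i) => [j|] i_eq; subst i.
  rewrite -integral12_prod_meas1//= /fubini_F.
  rewrite integral0_eq// => a _; have partialE v : partial (lift ord0 j) F (rV_cons (a, v)) =
      partial j (fun v => F (rV_cons (a, v))) v.
    by apply: (derive_congr _).2 => h; rewrite rV_cons_shift_lift.
  under eq_integral do rewrite partialE.
  apply: IH.
  - move=> v; have := dF (rV_cons (a, v)).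
    by rewrite (derive_congr (G := fun v => F (rV_cons (a, v))) (y := v)
      (w := delta_mx ord0 j)) => [//|h]; rewrite rV_cons_shift_lift.
  - rewrite (_ : partial _ _ = fun v => partial (lift ord0 j) F (rV_cons (a, v))).
      by move=> v; apply: continuous_comp; [exact: continuous_rV_cons_r|exact: cF].
    by apply/funext => v.
  - exact: cube_supported_cons_r.
  - by move=> v vM; rewrite -partialE; exact: (cube_supported_cons_r a spF).
(* For the first coordinate the order of integration is exchanged, so that the inner integral is
   one-dimensional. *)
rewrite -integral21_prod_meas1//= /fubini_G.
rewrite integral0_eq// => v _; apply: (@integral_derive_supported
  (fun a => F (rV_cons (a, v))) _ M).
- move=> a; have := dF (rV_cons (a, v)).
  by rewrite (derive_congr (G := fun a => F (rV_cons (a, v))) (y := a) (w := 1))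
    => [//|h]; rewrite rV_cons_shift0.
- move=> a; apply/esym; rewrite /partial.
  by apply: (derive_congr _).2 => h; rewrite rV_cons_shift0.
- by move=> a; apply: continuous_comp; [exact: continuous_rV_cons_l|exact: cF].
- by move=> a; exact: cube_supported_cons_l.
- by move=> a; exact: cube_supported_cons_l.
Qed.

Lemma integral_partial_mul n (i : 'I_n) (f g : 'rV[R]_n -> R) M :
  continuous f -> continuous g ->
  (forall x, derivable f x (delta_mx ord0 i)) ->
  (forall x, derivable g x (delta_mx ord0 i)) ->
  continuous (partial i f) -> continuous (partial i g) ->
  cube_supported M f -> cube_supported M (partial i f) ->
  \int[lebesgue_rV R n]_x (partial i f x * g x) =
  - \int[lebesgue_rV R n]_x (f x * partial i g x).
Proof.
move=> cf cg df dg cpf cpg sf spf.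
have pE : partial i (f * g) = (fun x => f x * partial i g x + partial i f x * g x).
  by apply/funext => x; rewrite /partial deriveM// [X in _ + X]mulrC.
have c1 : continuous (fun x => f x * partial i g x).
  by move=> x; exact: (cvgM (cf x) (cpg x)).
have c2 : continuous (fun x => partial i f x * g x).
  by move=> x; exact: (cvgM (cpf x) (cg x)).
have s1 : cube_supported M (fun x => f x * partial i g x).
  by move=> x /sf ->; rewrite mul0r.
have s2 : cube_supported M (fun x => partial i f x * g x).
  by move=> x /spf ->; rewrite mul0r.
have int0 : (\int[lebesgue_rV R n]_x (partial i (f * g) x)%:E = 0)%E.
  apply: (@integral_partial _ i _ M).
  - by move=> x; exact: derivableM.
  - by rewrite pE => x; exact: (cvgD (c1 x) (c2 x)).
  - by move=> x /sf fx; change (f x * g x = 0); rewrite fx mul0r.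
  - by move=> x xM; rewrite pE /= s1// s2// addr0.
apply/eqP; rewrite -addr_eq0 addrC -RintegralD//;
  [|exact: (cube_supported_integrable c1 s1)|exact: (cube_supported_integrable c2 s2)].
by move: int0; rewrite pE /Rintegral => ->.
Qed.

End integration_by_parts.

(** * Test functions *)

Section test_functions.
Variables (R : realType) (n : nat).
Local Notation E := 'rV[R]_n.
Local Notation C := R[i].
Local Notation Re := complex.Re.
Local Notation Im := complex.Im.
Implicit Types (f g : E -> R) (phi psi : E -> C) (Omega : set E).

(** The only linear operation of the development: [sub_comb] and [mulC_comb] bring differences and
    scalar multiples into this form, the latter as u + (a - 1) u, so closure and continuity are
    proved once. *)
Definition comb (T : Type) (u : T -> C) (a : C) (v : T -> C) : T -> C :=
  fun x => u x + a * v x.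

Lemma cReD (z w : C) : Re (z + w) = Re z + Re w. Proof. by case: z; case: w. Qed.
Lemma cImD (z w : C) : Im (z + w) = Im z + Im w. Proof. by case: z; case: w. Qed.
Lemma cReM (z w : C) : Re (z * w) = Re z * Re w - Im z * Im w.
Proof. by case: z; case: w. Qed.
Lemma cImM (z w : C) : Im (z * w) = Re z * Im w + Im z * Re w.
Proof. by case: z; case: w. Qed.
Lemma cReJ (z : C) : Re z^* = Re z. Proof. by case: z. Qed.
Lemma cImJ (z : C) : Im z^* = - Im z. Proof. by case: z. Qed.
Lemma Re_eq0 (z : C) : z = 0 -> Re z = 0. Proof. by move=> ->. Qed.
Lemma Im_eq0 (z : C) : z = 0 -> Im z = 0. Proof. by move=> ->. Qed.

Lemma Re_comb phi a psi : (fun x => Re (comb phi a psi x)) =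
  (fun x => Re (phi x)) + Re a *: (fun x => Re (psi x)) + (- Im a) *: (fun x => Im (psi x)).
Proof.
by apply/funext => x; rewrite cReD cReM addrA -mulNr.
Qed.

Lemma Im_comb phi a psi : (fun x => Im (comb phi a psi x)) =
  (fun x => Im (phi x)) + Re a *: (fun x => Im (psi x)) + Im a *: (fun x => Re (psi x)).
Proof. by apply/funext => x; rewrite cImD cImM addrA. Qed.

Lemma iter_partial_addZ f g a s : smooth f -> smooth g ->
  iter_partial s (f + a *: g) = iter_partial s f + a *: iter_partial s g.
Proof.
move=> sf sg; elim: s => // i s /= ->; apply/funext => x; rewrite /partial.
have df := (sf s).2 i x; have dg := (sg s).2 i x.
rewrite (deriveD df (derivableZ dg)) (deriveZ a dg); reflexivity.
Qed.

Lemma partial_addZ f g a i : smooth f -> smooth g ->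
  partial i (f + a *: g) = partial i f + a *: partial i g.
Proof. exact: (@iter_partial_addZ f g a [:: i]). Qed.

Lemma smooth_addZ f g a : smooth f -> smooth g -> smooth (f + a *: g).
Proof.
move=> sf sg s; rewrite (iter_partial_addZ a s sf sg).
have [cf df] := sf s; have [cg dg] := sg s; split=> [x|i x].
  exact: (cvgD (cf x) (cvgMl_tmp (a := a) (cg x))).
exact: (derivableD (df i x) (derivableZ (dg i x))).
Qed.

Lemma smooth0 : smooth (0 : E -> R).
Proof.
have it0 s : iter_partial s (0 : E -> R) = 0.
  by elim: s => // i s /= ->; apply/funext => x; rewrite /partial derive_cst.
by move=> s; rewrite it0; split=> [|i x]; [exact: (@cst_continuous E R 0)|exact: (@derivable_cst R E R 0)].
Qed.

Lemma test_fun0 Omega : test_fun Omega (0 : E -> C).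
Proof.
rewrite /test_fun; have -> : [set x : E | (0 : E -> C) x != 0] = set0.
  by apply/seteqP; split=> // x /=; rewrite eqxx.
by rewrite closure0; split; [exact: smooth0|exact: smooth0|exact: compact0|].
Qed.

Lemma compact_support_sub (phi psi : E -> C) (K : set E) : compact K ->
  [set x | psi x != 0] `<=` K -> compact (closure [set x | psi x != 0]) /\
    closure [set x | psi x != 0] `<=` K.
Proof.
move=> cK sub; have clK : closed K by apply: compact_closed => //; exact: norm_hausdorff.
have clsub : closure [set x | psi x != 0] `<=` K.
  by rewrite [X in _ `<=` X](closure_id K).1//; exact: closure_subset.
by split=> //; apply: subclosed_compact cK clsub; exact: closed_closure.
Qed.

Lemma test_fun_comb Omega phi a psi : test_fun Omega phi -> test_fun Omega psi ->
  test_fun Omega (comb phi a psi).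
Proof.
move=> [s1 s2 cphi iphi] [t1 t2 cpsi ipsi].
have cK := compactU cphi cpsi.
have [|c1 c2] := @compact_support_sub phi (comb phi a psi) _ cK.
  move=> x /=; rewrite /comb; have [->|phi0 _] := eqVneq (phi x) 0; last first.
    by left; exact: subset_closure.
  have [->|psi0 _] := eqVneq (psi x) 0; first by rewrite mulr0 addr0 eqxx.
  by right; exact: subset_closure.
split; [rewrite Re_comb|rewrite Im_comb|exact: c1|by move=> x /c2 [/iphi|/ipsi]].
  exact: (smooth_addZ _ (smooth_addZ _ s1 t1) t2).
exact: (smooth_addZ _ (smooth_addZ _ s2 t2) t1).
Qed.

Lemma grad_comb Omega phi a psi i : test_fun Omega phi -> test_fun Omega psi ->
  grad (comb phi a psi) i = comb (grad phi i) a (grad psi i).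
Proof.
move=> [s1 s2 _ _] [t1 t2 _ _]; apply/funext => x; rewrite /grad.
have st := smooth_addZ (Re a) s1 t1; have st' := smooth_addZ (Re a) s2 t2.
rewrite Re_comb Im_comb (partial_addZ _ i st t2) (partial_addZ _ i st' t1).
rewrite (partial_addZ _ i s1 t1) (partial_addZ _ i s2 t2).
apply/eqP; rewrite eq_complex cReD cImD cReM cImM /=.
by apply/andP; split; apply/eqP; rewrite addrA -?mulNr.
Qed.

(** The weak gradient in [W1] is defined by a pairing without conjugation, whereas [inner]
    conjugates its first argument; replacing a test function by its conjugate passes from one to the
    other. *)
Lemma test_fun_conj Omega phi : test_fun Omega phi -> test_fun Omega (fun x => (phi x)^*).
Proof.
move=> [s1 s2 cphi iphi].
have supE : [set x | (phi x)^* != 0] = [set x | phi x != 0].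
  by apply/seteqP; split=> x /=; rewrite !eq_complex cReJ cImJ oppr_eq0.
rewrite /test_fun supE; split; [| |exact: cphi|exact: iphi].
  by rewrite (_ : (fun x => _) = (fun x => Re (phi x))); [exact: s1|apply/funext => x; rewrite cReJ].
rewrite (_ : (fun x => _) = 0 + (-1) *: (fun x => Im (phi x))).
  exact: (smooth_addZ _ smooth0 s2).
by apply/funext => x; rewrite cImJ /= add0r; change (- Im (phi x) = -1 * Im (phi x)); rewrite mulN1r.
Qed.

Lemma grad_conj Omega phi i : test_fun Omega phi ->
  grad (fun x => (phi x)^*) i = fun x => (grad phi i x)^*.
Proof.
move=> [s1 s2 _ _]; apply/funext => x; rewrite /grad.
under eq_fun do rewrite cReJ.
rewrite (_ : (fun x => Im (phi x)^*) = 0 + (-1) *: (fun x => Im (phi x))); last first.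
  by apply/funext => y; rewrite cImJ /= add0r; change (- Im (phi y) = -1 * Im (phi y)); rewrite mulN1r.
rewrite (partial_addZ _ i smooth0 s2).
apply/eqP; rewrite eq_complex cReJ cImJ /= eqxx /=; apply/eqP.
transitivity (partial i (0 : E -> R) x + (-1) * partial i (fun y => Im (phi y)) x) => //.
by rewrite {1}/partial derive_cst add0r mulN1r.
Qed.

(** Off its closed support phi vanishes in a whole neighbourhood, hence so do its derivatives. The
    cube serves integrability and integration by parts; vanishing off [Omega] lets an integral over
    [Omega] be taken over the whole space. *)
Lemma test_fun_supp Omega phi : test_fun Omega phi ->
  exists2 M, (forall x, x \notin cube M -> phi x = 0 /\ forall i, grad phi i x = 0) &
    forall x, ~ Omega x -> phi x = 0 /\ forall i, grad phi i x = 0.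
Proof.
move=> [_ _ cphi iphi].
have out x : ~ closure [set y | phi y != 0] x -> phi x = 0 /\ forall i, grad phi i x = 0.
  move=> xcl; have near0 : \forall y \near x, phi y = 0.
    have : (~` [set y | phi y != 0])° x by rewrite interiorC.
    by apply: filterS => y /negP /negPn /eqP.
  split=> [|i]; first exact: nbhs_singleton near0.
  apply/eqP; rewrite eq_complex /=; apply/andP; split; apply/eqP.
    rewrite /partial (@near_eq_derive _ _ _ _ (cst 0)) ?derive_cst//.
    by apply: filterS near0 => y ->.
  rewrite /partial (@near_eq_derive _ _ _ _ (cst 0)) ?derive_cst//.
  by apply: filterS near0 => y ->.
have [M [_ HM]] := compact_bounded cphi.
exists (`|M| + 1) => x; last by move=> Ox; apply: out => /iphi.
move=> /cubeP[i xi]; apply: out => /(HM (`|M| + 1)).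
move=> /(_ _)/wrap[|]; first by rewrite (le_lt_trans (ler_norm _))// ltrDl.
move=> xM; have : `|x ord0 i| <= `|x|.
  by rewrite [leRHS]/Num.Def.normr /= mx_normrE; apply/bigmax_geP; right; exists (ord0, i).
by move=> /le_trans /(_ xM); rewrite leNgt xi.
Qed.

End test_functions.

(** * Complex square-integrable functions *)

Section complex_L2.
Variables (R : realType) (n : nat) (Omega : set 'rV[R]_n).
Hypothesis mO : measurable Omega.
Local Notation E := 'rV[R]_n.
Local Notation C := R[i].
Local Notation Re := complex.Re.
Local Notation Im := complex.Im.
Local Notation mu := (lebesgue_rV R n).
Local Notation sq := (sqint mu Omega).
Implicit Types (u v w : E -> C).

Lemma L2P u : L2 Omega u <-> sq (fun x => Re (u x)) /\ sq (fun x => Im (u x)).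
Proof.
split=> [[mr mi iu]|[[mr ir] [mi ii]]].
  split; split=> //.
    apply: norm_le_integrable iu => //; first exact: measurable_funX.
    by move=> x _; rewrite ger0_norm ?sqr_ge0// lerDl sqr_ge0.
  apply: norm_le_integrable iu => //; first exact: measurable_funX.
  by move=> x _; rewrite ger0_norm ?sqr_ge0// lerDr sqr_ge0.
by split=> //; have := integrableD mO ir ii; apply: eq_integrable.
Qed.

Lemma sqint_comb_Re u a v : L2 Omega u -> L2 Omega v -> sq (fun x => Re (comb u a v x)).
Proof.
move=> /L2P[ur ui] /L2P[vr vi]; rewrite Re_comb.
exact: (sqint_lin mO (- Im a) (sqint_lin mO (Re a) ur vr) vi).
Qed.

Lemma sqint_comb_Im u a v : L2 Omega u -> L2 Omega v -> sq (fun x => Im (comb u a v x)).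
Proof.
move=> /L2P[ur ui] /L2P[vr vi]; rewrite Im_comb.
exact: (sqint_lin mO (Im a) (sqint_lin mO (Re a) ui vi) vr).
Qed.

Lemma L2_comb u a v : L2 Omega u -> L2 Omega v -> L2 Omega (comb u a v).
Proof. by move=> Lu Lv; apply/L2P; split; [exact: sqint_comb_Re|exact: sqint_comb_Im]. Qed.

Lemma mulC_comb (a : C) u : (fun x => a * u x) = comb u (a - 1) u.
Proof. by apply/funext => x; rewrite /comb mulrBl mul1r addrC subrK. Qed.

Lemma L2_mulC a u : L2 Omega u -> L2 Omega (fun x => a * u x).
Proof. by move=> Lu; rewrite mulC_comb; exact: L2_comb. Qed.

Lemma sub_comb u v : (fun x => u x - v x) = comb u (-1)%:C v.
Proof.
by apply/funext => x; rewrite /comb rmorphN rmorph1 mulN1r.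
Qed.

Lemma L2B u v : L2 Omega u -> L2 Omega v -> L2 Omega (fun x => u x - v x).
Proof. by rewrite sub_comb; exact: L2_comb. Qed.

(* Re <u | v>; by [innerE] the imaginary part of <u | v> is [rin ('i * u) v], so
   everything can be done with this real inner product. *)
Definition rin u v : R :=
  ip mu Omega (fun x => Re (u x)) (fun x => Re (v x)) +
  ip mu Omega (fun x => Im (u x)) (fun x => Im (v x)).

Lemma rin_sym u v : rin u v = rin v u.
Proof. by rewrite /rin ip_sym [X in _ + X]ip_sym. Qed.

Lemma rin_ge0 u : 0 <= rin u u.
Proof. by rewrite addr_ge0 ?ip_ge0. Qed.

Lemma rin_combC u a v w : L2 Omega u -> L2 Omega v -> L2 Omega w ->
  rin (comb u a v) w = rin u w + Re a * rin v w + Im a * rin (fun x => 'i * v x) w.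
Proof.
move=> /L2P[ur ui] /L2P[vr vi] /L2P[wr wi]; rewrite /rin Re_comb Im_comb.
rewrite (ip_linl mO (- Im a) (sqint_lin mO (Re a) ur vr) vi wr).
rewrite (ip_linl mO (Im a) (sqint_lin mO (Re a) ui vi) vr wi).
rewrite (ip_linl mO (Re a) ur vr wr) (ip_linl mO (Re a) ui vi wi).
(* The opposite of Im v is written Im v + (-2) Im v to match the shape f + t g of [ip_linl]. *)
rewrite (_ : (fun x => Re ('i * v x)) = fun x => Im (v x) + (-2) * Im (v x)); last first.
  by apply/funext => x; case: (v x) => p q /=; ring.
rewrite (_ : (fun x => Im ('i * v x)) = fun x => Re (v x)); last first.
  by apply/funext => x; case: (v x) => p q /=; ring.
rewrite (ip_linl mO (-2) vi vi wr); ring.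
Qed.

Lemma rin_combl u (t : R) v w : L2 Omega u -> L2 Omega v -> L2 Omega w ->
  rin (comb u t%:C v) w = rin u w + t * rin v w.
Proof. by move=> Lu Lv Lw; rewrite rin_combC//= mul0r addr0. Qed.

Lemma rin_combr u (t : R) v w : L2 Omega u -> L2 Omega v -> L2 Omega w ->
  rin w (comb u t%:C v) = rin w u + t * rin w v.
Proof. by move=> Lu Lv Lw; rewrite rin_sym rin_combl// (rin_sym u) (rin_sym v). Qed.

Lemma rinBl u v w : L2 Omega u -> L2 Omega v -> L2 Omega w ->
  rin (fun x => u x - v x) w = rin u w - rin v w.
Proof. by move=> Lu Lv Lw; rewrite sub_comb rin_combl// mulN1r. Qed.

Lemma rinBr u v w : L2 Omega u -> L2 Omega v -> L2 Omega w ->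
  rin w (fun x => u x - v x) = rin w u - rin w v.
Proof. by move=> Lu Lv Lw; rewrite sub_comb rin_combr// mulN1r. Qed.

Lemma innerE u v : L2 Omega u -> L2 Omega v ->
  inner Omega u v = rin u v +i* rin (fun x => 'i * u x) v.
Proof.
move=> /L2P[ur ui] /L2P[vr vi]; rewrite /inner /Cintegral.
have i1 := sqint_mul mO ur vr; have i2 := sqint_mul mO ui vi.
have i3 := sqint_mul mO ur vi; have i4 := sqint_mul mO ui vr.
have i4N := integrableZl_EFin mO (-1) i4.
congr Complex.
  rewrite /rin /ip -RintegralD//; apply: eq_Rintegral => x _.
  by rewrite cReM cReJ cImJ; ring.
rewrite /rin.
rewrite (_ : (fun x => Re ('i * u x)) = fun x => - Im (u x)); last first.
  by apply/funext => x; case: (u x) => p q /=; ring.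
rewrite (_ : (fun x => Im ('i * u x)) = fun x => Re (u x)); last first.
  by apply/funext => x; case: (u x) => p q /=; ring.
rewrite [ip _ _ _ _](_ : _ = \int[mu]_(x in Omega) (-1 * (Im (u x) * Re (v x)))); last first.
  by apply: eq_Rintegral => x _; ring.
rewrite /ip -RintegralD//; apply: eq_Rintegral => x _.
by rewrite cImM cReJ cImJ; ring.
Qed.

Lemma norm2E u : L2 Omega u -> norm2 Omega u = Num.sqrt (rin u u).
Proof. by move=> Lu; rewrite /norm2 innerE. Qed.

Lemma sqr_norm2 u : L2 Omega u -> norm2 Omega u ^+ 2 = rin u u.
Proof. by move=> Lu; rewrite norm2E// sqr_sqrtr// rin_ge0. Qed.

Lemma norm2_ge0 u : 0 <= norm2 Omega u.
Proof. exact: sqrtr_ge0. Qed.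

Lemma rin_CauchySchwarz u v : L2 Omega u -> L2 Omega v ->
  `|rin u v| <= norm2 Omega u * norm2 Omega v.
Proof.
move=> Lu Lv; rewrite !norm2E// -sqrtrM ?rin_ge0// -sqrtr_sqr ler_sqrt; last first.
  by apply: mulr_ge0; exact: rin_ge0.
apply: (@semi_inner_CauchySchwarz _ _ (L2 Omega) (fun u t v => comb u t%:C v)) => //.
- by move=> *; exact: L2_comb.
- by move=> *; exact: rin_sym.
- by move=> *; exact: rin_combl.
- by move=> *; exact: rin_ge0.
Qed.

Lemma norm2_comb_le u (t : R) v : L2 Omega u -> L2 Omega v ->
  norm2 Omega (comb u t%:C v) <= norm2 Omega u + `|t| * norm2 Omega v.
Proof.
move=> Lu Lv; rewrite !norm2E//; last exact: L2_comb.
apply: (@semi_inner_triangle _ _ (L2 Omega) (fun u t v => comb u t%:C v)) => //.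
- by move=> *; exact: L2_comb.
- by move=> *; exact: rin_sym.
- by move=> *; exact: rin_combl.
- by move=> *; exact: rin_ge0.
Qed.

Lemma norm2_subC u v : L2 Omega u -> L2 Omega v ->
  norm2 Omega (fun x => u x - v x) = norm2 Omega (fun x => v x - u x).
Proof.
move=> Lu Lv; have L1 := L2B Lu Lv; have L2 := L2B Lv Lu.
rewrite !norm2E//; congr Num.sqrt; rewrite !rinBl ?rinBr//; ring.
Qed.

Lemma norm2_sub_le u v w : L2 Omega u -> L2 Omega v -> L2 Omega w ->
  norm2 Omega (fun x => u x - w x) <=
  norm2 Omega (fun x => u x - v x) + norm2 Omega (fun x => v x - w x).
Proof.
move=> Lu Lv Lw; have := norm2_comb_le 1 (L2B Lu Lv) (L2B Lv Lw).
rewrite normr1 mul1r; congr (norm2 _ _ <= _).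
by apply/funext => x; rewrite /comb rmorph1 mul1r addrA subrK.
Qed.

Lemma norm2_eq0_ae u v : L2 Omega u -> L2 Omega v ->
  norm2 Omega (fun x => u x - v x) = 0 -> ae_eqO Omega u v.
Proof.
move=> Lu Lv uv0; have Luv := L2B Lu Lv; have /L2P[sr si] := Luv.
have : rin (fun x => u x - v x) (fun x => u x - v x) = 0.
  by rewrite -sqr_norm2// uv0 expr0n.
move/eqP; rewrite paddr_eq0 ?ip_ge0// => /andP[/eqP r0 /eqP i0].
apply: filterS2 (ip_eq0 mO sr r0) (ip_eq0 mO si i0) => x Hr Hi Ox.
by apply/eqP; rewrite -subr_eq0 eq_complex /= Hr// Hi// !eqxx.
Qed.

Lemma rin_sub_sqdist u v :
  rin (fun x => u x - v x) (fun x => u x - v x) =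
  sqdist mu Omega (fun x => Re (u x)) (fun x => Re (v x)) +
  sqdist mu Omega (fun x => Im (u x)) (fun x => Im (v x)).
Proof.
rewrite /rin /sqdist.
have -> : (fun x => Re (u x - v x)) = (fun x => Re (u x) - Re (v x)).
  by apply/funext => x; case: (u x); case: (v x).
have -> // : (fun x => Im (u x - v x)) = (fun x => Im (u x) - Im (v x)).
by apply/funext => x; case: (u x); case: (v x).
Qed.

Definition cvL2 (u_ : nat -> E -> C) u : Prop :=
  (fun k => norm2 Omega (fun x => u_ k x - u x)) @ \oo --> (0 : R).

Lemma L2_complete (u_ : nat -> E -> C) : (forall k, L2 Omega (u_ k)) ->
  (forall e, 0 < e -> exists N, forall j k, (N <= j)%N -> (N <= k)%N ->
    norm2 Omega (fun x => u_ j x - u_ k x) <= e) ->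
  exists2 u, L2 Omega u & cvL2 u_ u.
Proof.
move=> Lu cu.
have cu2 e : 0 < e -> exists N, forall j k, (N <= j)%N -> (N <= k)%N ->
    rin (fun x => u_ j x - u_ k x) (fun x => u_ j x - u_ k x) <= e.
  move=> e0; have [|N HN] := cu (Num.sqrt e); first by rewrite sqrtr_gt0.
  exists N => j k Nj Nk; rewrite -sqr_norm2; last exact: L2B.
  apply: (@le_trans _ _ (Num.sqrt e ^+ 2)); last by rewrite sqr_sqrtr// ltW.
  by apply: lerXn2r; rewrite ?nnegrE ?norm2_ge0 ?sqrtr_ge0//; exact: HN.
have [|e e0|f sf cf] := @sqint_complete _ _ R mu Omega mO (fun k x => Re (u_ k x)).
- by move=> k; have /L2P[] := Lu k.
- have [N HN] := cu2 _ e0; exists N => j k Nj Nk.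
  by apply: le_trans (HN j k Nj Nk); rewrite rin_sub_sqdist lerDl ip_ge0.
have [|e e0|g sg cg] := @sqint_complete _ _ R mu Omega mO (fun k x => Im (u_ k x)).
- by move=> k; have /L2P[] := Lu k.
- have [N HN] := cu2 _ e0; exists N => j k Nj Nk.
  by apply: le_trans (HN j k Nj Nk); rewrite rin_sub_sqdist lerDr ip_ge0.
have Lfg : L2 Omega (fun x => f x +i* g x) by apply/L2P.
exists (fun x => f x +i* g x) => //; apply/cvgrPdist_le => e e0.
have e20 : 0 < e ^+ 2 / 2 by rewrite divr_gt0// exprn_gt0.
have [N1 H1] := cf _ e20; have [N2 H2] := cg _ e20.
exists (maxn N1 N2) => // k /=; rewrite geq_max => /andP[N1k N2k].
rewrite sub0r normrN ger0_norm ?norm2_ge0// norm2E; last exact: L2B.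
rewrite -(ger0_norm (ltW e0)) -sqrtr_sqr ler_sqrt ?sqr_ge0//.
apply: (@le_trans _ _ (e ^+ 2 / 2 + e ^+ 2 / 2)); last by rewrite -splitr.
apply: le_trans (lerD (H1 k N1k) (H2 k N2k)).
by rewrite rin_sub_sqdist.
Qed.

Lemma rin_cvg (u_ v_ : nat -> E -> C) u v :
  (forall k, L2 Omega (u_ k)) -> L2 Omega u -> (forall k, L2 Omega (v_ k)) -> L2 Omega v ->
  cvL2 u_ u -> cvL2 v_ v ->
  (fun k => rin (u_ k) (v_ k)) @ \oo --> rin u v.
Proof.
move=> Lu_ Lu Lv_ Lv cu cv; apply/(@subr_cvg0 R R^o).
pose du k := norm2 Omega (fun x => u_ k x - u x).
pose dv k := norm2 Omega (fun x => v_ k x - v x).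
have bnd : (fun k => du k * dv k + du k * norm2 Omega v + norm2 Omega u * dv k) @ \oo --> (0 : R).
  rewrite (_ : 0 = 0 * 0 + 0 * norm2 Omega v + norm2 Omega u * 0); last by ring.
  apply: cvgD; first apply: cvgD.
  - exact: cvgM.
  - by apply: cvgM => //; exact: cvg_cst.
  - by apply: cvgM => //; exact: cvg_cst.
apply: (@norm_cvg0 R R^o); apply: (@squeeze_cvgr _ _ _ _ (fun=> 0)) bnd; last exact: cvg_cst.
apply: nearW => k; rewrite normr_ge0 /=.
have L1 := L2B (Lu_ k) Lu; have L2' := L2B (Lv_ k) Lv.
have -> : rin (u_ k) (v_ k) - rin u v =
   rin (fun x => u_ k x - u x) (fun x => v_ k x - v x) +
   rin (fun x => u_ k x - u x) v + rin u (fun x => v_ k x - v x).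
  by rewrite !rinBl// !rinBr//; ring.
rewrite (le_trans (ler_normD _ _))// lerD//; last exact: rin_CauchySchwarz.
by rewrite (le_trans (ler_normD _ _))// lerD//; exact: rin_CauchySchwarz.
Qed.

End complex_L2.

(** * Multiplication by essentially bounded real weights *)

Lemma inv_measurable (R : realType) : measurable_fun [set: R] (@GRing.inv R).
Proof.
have -> : [set: R] = [set~ 0] `|` [set 0] by rewrite setUC setUv.
have o0 : open [set~ (0 : R)] by apply: closed_openC; exact: closed_eq.
apply/measurable_funU; [exact: open_measurable|exact: measurable_set1|split].
  apply: open_continuous_measurable_fun => // x; rewrite inE /= => /eqP x0.
  exact: inv_continuous.
exact: measurable_fun_set1.
Qed.

Section weighted.
Variables (R : realType) (n : nat) (Omega : set 'rV[R]_n).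
Hypothesis mO : measurable Omega.
Local Notation E := 'rV[R]_n.
Local Notation C := R[i].
Local Notation Re := complex.Re.
Local Notation Im := complex.Im.
Local Notation mu := (lebesgue_rV R n).
Local Notation rin := (rin Omega).
Implicit Types (u v w : E -> C) (b c p : E -> R).

Definition weight b u : E -> C := fun x => (b x)%:C * u x.

Definition ess_bounded M b := measurable_fun Omega b /\
  {ae mu, forall x, Omega x -> `|b x| <= M}.

Lemma Re_weight b u : (fun x => Re (weight b u x)) = fun x => b x * Re (u x).
Proof. by apply/funext => x; rewrite cReM /= mul0r subr0. Qed.

Lemma Im_weight b u : (fun x => Im (weight b u x)) = fun x => b x * Im (u x).
Proof. by apply/funext => x; rewrite cImM /= mul0r addr0. Qed.

Lemma L2_weight M b u : 0 <= M -> ess_bounded M b -> L2 Omega u -> L2 Omega (weight b u).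
Proof.
move=> M0 [mb bM] /(L2P mO)[ur ui]; apply/(L2P mO); rewrite Re_weight Im_weight.
by split; exact: sqint_bounded_mul M0 _ _.
Qed.

Lemma le_rin_weight b c u : L2 Omega u -> L2 Omega (weight b u) ->
  L2 Omega (weight c u) -> {ae mu, forall x, Omega x -> b x <= c x} ->
  rin u (weight b u) <= rin u (weight c u).
Proof.
move=> /(L2P mO)[ur ui] /(L2P mO); rewrite Re_weight Im_weight => -[br bi].
move=> /(L2P mO); rewrite Re_weight Im_weight => -[cr ci] bc.
by rewrite /rin !Re_weight !Im_weight lerD//; exact: le_ip_weight.
Qed.

Lemma rin_weightC b u v : rin u (weight b v) = rin (weight b u) v.
Proof.
rewrite /rin !Re_weight !Im_weight.
by congr (_ + _); apply: eq_Rintegral => x _; rewrite mulrCA mulrA.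
Qed.

Lemma norm2_weight M b u : 0 <= M -> ess_bounded M b -> L2 Omega u ->
  norm2 Omega (weight b u) <= M * norm2 Omega u.
Proof.
move=> M0 bM Lu; have Lbu := L2_weight M0 bM Lu.
rewrite !norm2E// -[X in X * _](ger0_norm M0) -sqrtr_sqr -sqrtrM ?sqr_ge0//.
rewrite ler_sqrt; last by apply: mulr_ge0; [exact: sqr_ge0|exact: rin_ge0].
move/(L2P mO): Lbu; rewrite Re_weight Im_weight => -[br bi].
move/(L2P mO): Lu => [ur ui]; have [_ aebM] := bM.
by rewrite /rin !Re_weight !Im_weight mulrDr lerD//; exact: ip_weight_bound.
Qed.

Lemma cvL2_weight M b (u_ : nat -> E -> C) u : 0 <= M -> ess_bounded M b ->
  (forall k, L2 Omega (u_ k)) -> L2 Omega u -> cvL2 Omega u_ u ->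
  cvL2 Omega (fun k => weight b (u_ k)) (weight b u).
Proof.
move=> M0 bM Lu_ Lu cu.
have bnd : (fun k => M * norm2 Omega (fun x => u_ k x - u x)) @ \oo --> (0 : R).
  by rewrite -(mulr0 M); apply: cvgM => //; exact: cvg_cst.
apply: (@squeeze_cvgr _ _ _ _ (fun=> 0)) bnd; last exact: cvg_cst.
apply: nearW => k; rewrite norm2_ge0 /=.
have -> : (fun x => weight b (u_ k) x - weight b u x) =
    weight b (fun x => u_ k x - u x) by apply/funext => x; rewrite /weight mulrBr.
by apply: norm2_weight => //; exact: L2B.
Qed.

Lemma coef_inv p : coef Omega p -> exists C1 C2 : R, [/\ 0 < C1, 0 < C2,
  ess_bounded C1^-1 (fun x => 1 / p x) &
  {ae mu, forall x, Omega x -> C2^-1 <= 1 / p x}].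
Proof.
move=> [mp [C1 [C2 [C10 C12 Cp]]]]; exists C1, C2; have C20 := lt_le_trans C10 C12.
split=> //; last first.
  apply: filterS Cp => x + Ox => /(_ Ox)/andP[C1p pC2].
  by rewrite div1r lef_pV2// posrE (lt_le_trans C10).
split.
  under eq_fun do rewrite div1r.
  by apply: (measurableT_comp (@inv_measurable R)).
apply: filterS Cp => x + Ox => /(_ Ox)/andP[C1p pC2].
have p0 : 0 < p x by exact: lt_le_trans C1p.
by rewrite div1r gtr0_norm ?invr_gt0// lef_pV2// posrE.
Qed.

End weighted.

(** * Sobolev functions *)

Section sobolev.
Variables (R : realType) (n : nat) (Omega : set 'rV[R]_n).
Hypothesis oO : open Omega.
Let mO : measurable Omega := measurable_open_rV oO.
Local Notation E := 'rV[R]_n.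
Local Notation C := R[i].
Local Notation Re := complex.Re.
Local Notation Im := complex.Im.
Local Notation mu := (lebesgue_rV R n).
Local Notation rin := (rin Omega).
Local Notation cvL2 := (cvL2 Omega).
Implicit Types (u v w phi psi : E -> C) (g h : 'I_n -> E -> C) (b c p : E -> R).

Lemma cube_supported_sqint (f : E -> R) M : continuous f -> cube_supported M f ->
  sqint mu Omega f.
Proof.
move=> cf sf; split; first by apply: measurable_funTS; exact: continuous_measurable_rV.
rewrite (_ : (fun x => _) = EFin \o (fun x => f x * f x)); last first.
  by apply/funext => x; rewrite expr2.
apply: (@integrableS _ _ _ _ setT) => //.
apply: (@cube_supported_integrable _ _ M).
  by move=> x; exact: (cvgM (cf x) (cf x)).
by move=> x /sf ->; rewrite mul0r.
Qed.

Lemma test_fun_L2 phi : test_fun Omega phi ->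
  L2 Omega phi /\ forall i, L2 Omega (grad phi i).
Proof.
move=> tphi; have [M sM _] := test_fun_supp tphi; have [sr si _ _] := tphi.
split=> [|i]; apply/(L2P mO); split; apply: (@cube_supported_sqint _ M).
- by have [] := sr [::].
- by move=> x /sM [-> _].
- by have [] := si [::].
- by move=> x /sM [-> _].
- by have [] := sr [:: i].
- by move=> x /sM [_ /(_ i) /Re_eq0].
- by have [] := si [:: i].
- by move=> x /sM [_ /(_ i) /Im_eq0].
Qed.

Lemma ip_setT (f g : E -> R) : (forall x, ~ Omega x -> f x = 0) ->
  ip mu Omega f g = \int[mu]_x (f x * g x).
Proof.
move=> f0; rewrite /ip Rintegral_mkcond; apply: eq_Rintegral => x _.
by rewrite patchE; case: ifPn => // /negP xO; rewrite f0 ?mul0r// => /mem_set.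
Qed.

Lemma rin_grad phi psi i : test_fun Omega phi -> test_fun Omega psi ->
  rin (grad phi i) psi = - rin phi (grad psi i).
Proof.
move=> tphi tpsi; have [M sM sO] := test_fun_supp tphi.
have [sr si _ _] := tphi; have [tr ti _ _] := tpsi.
have [cr dr] := sr [::]; have [ci di] := si [::].
have [cr' dr'] := tr [::]; have [ci' di'] := ti [::].
have [pr _] := sr [:: i]; have [pi _] := si [:: i].
have [pr' _] := tr [:: i]; have [pi' _] := ti [:: i].
rewrite /rin opprD; congr (_ + _); rewrite !ip_setT.
- apply: (integral_partial_mul cr cr' (dr i) (dr' i) pr pr' (M := M)).
    by move=> x /sM [/Re_eq0].
  by move=> x /sM [_ /(_ i) /Re_eq0].
- by move=> x /sO [-> _].
- by move=> x /sO [_ /(_ i) /Re_eq0].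
- apply: (integral_partial_mul ci ci' (di i) (di' i) pi pi' (M := M)).
    by move=> x /sM [/Im_eq0].
  by move=> x /sM [_ /(_ i) /Im_eq0].
- by move=> x /sO [-> _].
- by move=> x /sO [_ /(_ i) /Im_eq0].
Qed.

(* [inner] is defined with the conjugation of [numClosedFieldType], which computes
   to [conjc]. *)
Lemma Num_conj_conjc (z : C) : Num.conj (conjc z) = z.
Proof. exact: conjcK. Qed.

Lemma test_fun_mulC a phi : test_fun Omega phi -> test_fun Omega (fun x => a * phi x).
Proof. by move=> tphi; rewrite mulC_comb; exact: test_fun_comb. Qed.

Lemma grad_mulC a phi i : test_fun Omega phi ->
  grad (fun x => a * phi x) i = fun x => a * grad phi i x.
Proof. by move=> tphi; rewrite !mulC_comb (grad_comb _ i tphi tphi). Qed.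

Lemma L2_lim_unique (u_ : nat -> E -> C) u v : (forall k, L2 Omega (u_ k)) ->
  L2 Omega u -> L2 Omega v -> cvL2 u_ u -> cvL2 u_ v ->
  norm2 Omega (fun x => u x - v x) = 0.
Proof.
move=> Lu_ Lu Lv cu cv; apply/eqP; rewrite eq_le norm2_ge0 andbT.
have /cvg_lim <- // : (fun k => norm2 Omega (fun x => u_ k x - u x) +
    norm2 Omega (fun x => u_ k x - v x)) @ \oo --> (0 : R).
  by rewrite -(addr0 0); exact: cvgD.
apply: limr_ge; first by apply: is_cvgD; apply/cvg_ex; exists 0.
apply: nearW => k; apply: (le_trans (norm2_sub_le mO Lu (Lu_ k) Lv)).
by rewrite (norm2_subC mO Lu (Lu_ k)).
Qed.

Lemma rin_self u : L2 Omega u ->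
  rin u u = \int[mu]_(x in Omega) (Re (u x) ^+ 2 + Im (u x) ^+ 2).
Proof.
move=> /(L2P mO)[ur ui]; have ir := sqint_mul mO ur ur; have ii := sqint_mul mO ui ui.
by rewrite /rin /ip -RintegralD.
Qed.

Lemma norm2_mulC a u : L2 Omega u ->
  norm2 Omega (fun x => a * u x) = Num.sqrt (Re a ^+ 2 + Im a ^+ 2) * norm2 Omega u.
Proof.
move=> Lu; have Lau := L2_mulC mO a Lu.
rewrite !norm2E// -sqrtrM ?addr_ge0 ?sqr_ge0//; congr Num.sqrt.
rewrite !rin_self// -RintegralZl//; last by case: Lu.
by apply: eq_Rintegral => x _; rewrite cReM cImM; ring.
Qed.

Lemma cvL2_cst u : L2 Omega u -> cvL2 (fun=> u) u.
Proof.
move=> Lu; rewrite /cvL2 (norm2E mO (L2B mO Lu Lu)).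
by rewrite (rinBl mO Lu Lu (L2B mO Lu Lu)) subrr sqrtr0; exact: cvg_cst.
Qed.

Lemma cvL2_comb (u_ v_ : nat -> E -> C) u v a :
  (forall k, L2 Omega (u_ k)) -> L2 Omega u -> (forall k, L2 Omega (v_ k)) -> L2 Omega v ->
  cvL2 u_ u -> cvL2 v_ v -> cvL2 (fun k => comb (u_ k) a (v_ k)) (comb u a v).
Proof.
move=> Lu_ Lu Lv_ Lv cu cv; set A := Num.sqrt (Re a ^+ 2 + Im a ^+ 2).
have bnd : (fun k => norm2 Omega (fun x => u_ k x - u x) +
    A * norm2 Omega (fun x => v_ k x - v x)) @ \oo --> (0 : R).
  rewrite -(addr0 0) -{2}(mulr0 A); apply: cvgD => //.
  by apply: cvgM => //; exact: cvg_cst.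
apply: (@squeeze_cvgr _ _ _ _ (fun=> 0)) bnd; last exact: cvg_cst.
apply: nearW => k; rewrite norm2_ge0 /=.
have Ldu := L2B mO (Lu_ k) Lu; have Ldv := L2B mO (Lv_ k) Lv.
rewrite /A -norm2_mulC// -[X in _ + X]mul1r -[X in _ + X * _](@normr1 R).
apply: le_trans (norm2_comb_le mO 1 Ldu (L2_mulC mO a Ldv)).
rewrite le_eqVlt; apply/orP; left; apply/eqP; congr (norm2 _ _).
by apply/funext => x; rewrite /comb rmorph1; ring.
Qed.

Lemma cvg_sqr (f : nat -> R) (a : R) : f @ \oo --> a -> (fun k => f k ^+ 2) @ \oo --> a ^+ 2.
Proof. by move=> cf; under eq_fun do rewrite expr2; rewrite expr2; apply: cvgM. Qed.

Lemma cvg_sumr (f : 'I_n -> nat -> R) (a : 'I_n -> R) :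
  (forall i, f i @ \oo --> a i) -> (fun k => \sum_i f i k) @ \oo --> \sum_i a i.
Proof.
move=> cf; rewrite -![index_enum _]/(index_enum 'I_n); elim: (index_enum _) => [|i r IH].
  by under eq_fun do rewrite big_nil; rewrite big_nil; exact: cvg_cst.
under eq_fun do rewrite big_cons.
by rewrite big_cons; apply: cvgD; [exact: cf|exact: IH].
Qed.

(* By [W1_0P] this is [W1_0]: integration by parts shows that the limit of the
   gradients is the weak gradient of [u]. *)
Definition W10 u g : Prop := [/\ L2 Omega u, L2n Omega g &
  exists phi_ : nat -> E -> C, [/\ forall k, test_fun Omega (phi_ k), cvL2 phi_ u &
    forall i, cvL2 (fun k => grad (phi_ k) i) (g i)]].

Lemma W10_comb u g a v h : W10 u g -> W10 v h ->
  W10 (comb u a v) (fun i => comb (g i) a (h i)).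
Proof.
move=> [Lu Lg [phi [tphi cphi gphi]]] [Lv Lh [psi [tpsi cpsi gpsi]]].
split; [exact: L2_comb|by move=> i; exact: L2_comb|].
exists (fun k => comb (phi k) a (psi k)); split=> [k||i].
- exact: test_fun_comb.
- exact: (cvL2_comb a (fun k => (test_fun_L2 (tphi k)).1) Lu
    (fun k => (test_fun_L2 (tpsi k)).1) Lv).
- rewrite (_ : (fun k => _) = fun k => comb (grad (phi k) i) a (grad (psi k) i)); last first.
    by apply/funext => k; exact: grad_comb (tphi k) (tpsi k).
  have H := (@cvL2_comb (fun k => grad (phi k) i) (fun k => grad (psi k) i) _ _ a
    (fun k => (test_fun_L2 (tphi k)).2 i) (Lg i) (fun k => (test_fun_L2 (tpsi k)).2 i) (Lh i)).
  exact: (H (gphi i) (gpsi i)).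
Qed.

Lemma W10_weak_grad u g phi i : W10 u g -> test_fun Omega phi ->
  rin (grad phi i) u = - rin phi (g i).
Proof.
move=> [Lu Lg [psi [tpsi cpsi gpsi]]] tphi; have [Lphi Lgphi] := test_fun_L2 tphi.
have Lpsi k : L2 Omega (psi k) by have [] := test_fun_L2 (tpsi k).
have Lgpsi k : L2 Omega (grad (psi k) i) by have [] := test_fun_L2 (tpsi k).
have c1 := rin_cvg mO (fun=> Lgphi i) (Lgphi i) Lpsi Lu (cvL2_cst (Lgphi i)) cpsi.
have c2 := rin_cvg mO (fun=> Lphi) Lphi Lgpsi (Lg i) (cvL2_cst Lphi) (gpsi i).
have c1' : (fun k => - rin phi (grad (psi k) i)) @ \oo --> rin (grad phi i) u.
  by under eq_fun => k do rewrite -(rin_grad i tphi (tpsi k)).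
by rewrite -(cvg_lim _ c1')//; apply/cvg_lim => //; exact: cvgN.
Qed.

Lemma W1_0P u g : W1_0 Omega u g <-> W10 u g.
Proof.
split=> [[[Lu Lg _] app]|Wu].
  split=> //.
  have /choice[phi Hphi] : forall k : nat, exists phi, test_fun Omega phi /\
      W1_norm Omega (fun x => u x - phi x) (fun i x => g i x - grad phi i x) < k.+1%:R^-1.
    by move=> k; have [|phi tphi Wphi] := app k.+1%:R^-1; [rewrite invr_gt0|exists phi].
  have Lphi k := test_fun_L2 (proj1 (Hphi k)).
  exists phi; split=> [k||i]; first by case: (Hphi k).
    apply: (@squeeze_cvgr _ _ _ _ (fun=> 0)) (@cvg_harmonic R); last exact: cvg_cst.
    apply: nearW => k; rewrite norm2_ge0 /=; have [_ /ltW] := Hphi k.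
    apply: le_trans; rewrite (norm2_subC mO (Lphi k).1 Lu) /W1_norm.
    rewrite -[leLHS]ger0_norm ?norm2_ge0// -sqrtr_sqr ler_sqrt.
      by rewrite lerDl sumr_ge0// => j _; exact: sqr_ge0.
    by rewrite addr_ge0 ?sqr_ge0// sumr_ge0// => j _; exact: sqr_ge0.
  apply: (@squeeze_cvgr _ _ _ _ (fun=> 0)) (@cvg_harmonic R); last exact: cvg_cst.
  apply: nearW => k; rewrite norm2_ge0 /=; have [_ /ltW] := Hphi k.
  apply: le_trans; rewrite (norm2_subC mO ((Lphi k).2 i) (Lg i)) /W1_norm.
  rewrite -[leLHS]ger0_norm ?norm2_ge0// -sqrtr_sqr ler_sqrt.
    rewrite (bigD1 i)//= addrCA lerDl addr_ge0 ?sqr_ge0// sumr_ge0// => j _.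
    exact: sqr_ge0.
  by rewrite addr_ge0 ?sqr_ge0// sumr_ge0// => j _; exact: sqr_ge0.
have [Lu Lg [phi [tphi cphi gphi]]] := Wu.
have Lphi k := test_fun_L2 (tphi k).
split.
  split=> // psi tpsi i; have tpsiJ := test_fun_conj tpsi.
  have [LpsiJ LgpsiJ] := test_fun_L2 tpsiJ.
  transitivity (inner Omega (grad (fun x => (psi x)^*) i) u).
    rewrite (grad_conj i tpsi) /inner; congr Cintegral; apply/funext => x.
    by rewrite Num_conj_conjc mulrC.
  transitivity (- inner Omega (fun x => (psi x)^*) (g i)); last first.
    rewrite /inner; congr (- Cintegral _ _); apply/funext => x.
    by rewrite Num_conj_conjc mulrC.
  rewrite (innerE mO (LgpsiJ i) Lu) (innerE mO LpsiJ (Lg i)).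
  (* By [innerE], the imaginary part of the identity is its real part for the test function
     multiplied by ['i]. *)
  have tipsiJ := test_fun_mulC 'i tpsiJ.
  have := W10_weak_grad i Wu tpsiJ; have := W10_weak_grad i Wu tipsiJ.
  by rewrite (grad_mulC _ i tpsiJ) => -> ->.
move=> eps eps0.
have cvW : (fun k => W1_norm Omega (fun x => u x - phi k x)
    (fun i x => g i x - grad (phi k) i x)) @ \oo --> (0 : R).
  have c1 : (fun k => norm2 Omega (fun x => u x - phi k x)) @ \oo --> (0 : R).
    by under eq_fun => k do rewrite (norm2_subC mO Lu (Lphi k).1).
  have c2 i : (fun k => norm2 Omega (fun x => g i x - grad (phi k) i x)) @ \oo --> (0 : R).
    by under eq_fun => k do rewrite (norm2_subC mO (Lg i) ((Lphi k).2 i)); exact: gphi.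
  have := cvgD (cvg_sqr c1) (cvg_sumr (fun i => cvg_sqr (c2 i))).
  rewrite expr0n /= big1 // addr0 => c3; rewrite -(sqrtr0 R).
  rewrite /W1_norm; apply: (@continuous_cvg _ _ _ _ _ _ (@Num.sqrt R)); [exact: sqrt_continuous|exact: c3].
have /cvgrPdist_lt/(_ _ eps0)[k _ /(_ k (leqnn k))] := cvW.
rewrite /= sub0r normrN ger0_norm ?sqrtr_ge0// => Wk.
by exists (phi k).
Qed.

End sobolev.

(** * The diffusion operator and its inverse *)

Section diffusion_operator.
Variables (R : realType) (n : nat) (Omega : set 'rV[R]_n).
Hypothesis oO : open Omega.
Let mO : measurable Omega := measurable_open_rV oO.
Local Notation E := 'rV[R]_n.
Local Notation C := R[i].
Local Notation Re := complex.Re.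
Local Notation Im := complex.Im.
Local Notation mu := (lebesgue_rV R n).
Local Notation rin := (rin Omega).
Local Notation cvL2 := (cvL2 Omega).
Local Notation W10 := (W10 Omega).
Implicit Types (u v w f phi psi : E -> C) (g h : 'I_n -> E -> C) (p : E -> R).

Definition combn g (a : C) h : 'I_n -> E -> C := fun i => comb (g i) a (h i).

(* The real part of the sesquilinear form of the diffusion operator. *)
Definition aform p g h : R := \sum_i rin (g i) (weight (fun x => 1 / p x) (h i)).

Lemma L2_coef_weight p u : coef Omega p -> L2 Omega u ->
  L2 Omega (weight (fun x => 1 / p x) u).
Proof.
move=> /coef_inv [C1 [C2 [C10 _ bp _]]]; apply: (@L2_weight _ _ _ mO C1^-1) => //.
by rewrite invr_ge0 ltW.
Qed.

Lemma aform_sym p g h : aform p g h = aform p h g.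
Proof. by apply: eq_bigr => i _; rewrite rin_weightC rin_sym. Qed.

Lemma aform_combl p g (t : R) h g' : coef Omega p -> L2n Omega g -> L2n Omega h ->
  L2n Omega g' -> aform p (combn g t%:C h) g' = aform p g g' + t * aform p h g'.
Proof.
move=> cp Lg Lh Lg'; rewrite /aform mulr_sumr -big_split; apply: eq_bigr => i _ /=.
by rewrite rin_combl//; exact: L2_coef_weight.
Qed.

Lemma aform_sqr_combn p g h : coef Omega p -> L2n Omega g -> L2n Omega h ->
  forall t : R, aform p (combn g t%:C h) (combn g t%:C h) =
  aform p g g + 2 * t * aform p g h + t ^+ 2 * aform p h h.
Proof.
move=> cp Lg Lh t; have Lc : L2n Omega (combn g t%:C h) by move=> i; exact: L2_comb.
rewrite aform_combl// !(aform_sym p _ (combn _ _ _)) !aform_combl//.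
by rewrite (aform_sym p h g); ring.
Qed.

Lemma rin_weight_cst (t : R) u : L2 Omega u -> rin u (weight (fun=> t) u) = t * rin u u.
Proof.
move=> /(L2P mO)[ur ui]; rewrite /rin Re_weight Im_weight mulrDr.
have ir := sqint_mul mO ur ur; have ii := sqint_mul mO ui ui.
rewrite {1 4}/ip -[in X in _ + X]/(ip _ _ _ _) -!RintegralZl//.
by congr (_ + _); apply: eq_Rintegral => x _; rewrite mulrCA.
Qed.

(** Ellipticity: through it a sequence that is Cauchy for the form has gradients that converge in
    L^2. *)
Lemma aform_ge p : coef Omega p -> exists2 m : R, 0 < m &
  forall g, L2n Omega g -> m * \sum_i norm2 Omega (g i) ^+ 2 <= aform p g g.
Proof.
move=> cp; have [C1 [C2 [C10 C20 bp lbp]]] := coef_inv cp.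
exists C2^-1; first by rewrite invr_gt0.
move=> g Lg; rewrite mulr_sumr; apply: ler_sum => i _.
rewrite (sqr_norm2 mO (Lg i)) -(rin_weight_cst _ (Lg i)).
apply: (le_rin_weight mO (Lg i) _ (L2_coef_weight cp (Lg i)) lbp).
exact: (L2_mulC mO _ (Lg i)).
Qed.

Lemma sum_norm2_ge0 g : 0 <= \sum_i norm2 Omega (g i) ^+ 2.
Proof. by apply: sumr_ge0 => i _; exact: sqr_ge0. Qed.

Lemma aform_ge0 p g : coef Omega p -> L2n Omega g -> 0 <= aform p g g.
Proof.
move=> /aform_ge[m m0 am] Lg; apply: le_trans (am _ Lg).
by apply: mulr_ge0; [exact: ltW|exact: sum_norm2_ge0].
Qed.

Lemma aform_cvg p (g_ h_ : nat -> 'I_n -> E -> C) g h : coef Omega p ->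
  (forall k, L2n Omega (g_ k)) -> L2n Omega g -> (forall k, L2n Omega (h_ k)) ->
  L2n Omega h -> (forall i, cvL2 (fun k => g_ k i) (g i)) ->
  (forall i, cvL2 (fun k => h_ k i) (h i)) ->
  (fun k => aform p (g_ k) (h_ k)) @ \oo --> aform p g h.
Proof.
move=> cp Lg_ Lg Lh_ Lh cg ch; apply: cvg_sumr => i.
have [C1 [C2 [C10 C20 bp _]]] := coef_inv cp.
apply: (rin_cvg mO (fun k => Lg_ k i) (Lg i) (fun k => L2_coef_weight cp (Lh_ k i))
  (L2_coef_weight cp (Lh i)) (cg i)).
apply: (cvL2_weight mO _ bp (fun k => Lh_ k i) (Lh i) (ch i)).
by rewrite invr_ge0 ltW.
Qed.

Lemma complex_sum (x y : 'I_n -> R) :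
  \sum_i (x i +i* y i) = (\sum_i x i) +i* (\sum_i y i).
Proof.
by elim/big_rec3 : _ => // i a b c _ ->.
Qed.

(** Multiplication by ['i] is skew-adjoint for the real inner product; this moves the factor that
    encodes an imaginary part to the other argument. *)
Lemma rin_iC u v : L2 Omega u -> L2 Omega v ->
  rin (fun x => 'i * u x) v = - rin u (fun x => 'i * v x).
Proof.
move=> /(L2P mO)[ur ui] /(L2P mO)[vr vi].
have reE w : (fun x => Re ('i * w x)) = fun x => Im (w x) + (-2) * Im (w x).
  by apply/funext => x; case: (w x) => a b /=; ring.
have imE w : (fun x => Im ('i * w x)) = fun x => Re (w x).
  by apply/funext => x; case: (w x) => a b /=; ring.
rewrite /rin !reE !imE (ip_linl mO _ ui ui vr) (ip_sym _ _ (fun x => Re (u x))).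
by rewrite [in RHS](ip_linl mO _ vi vi ur) (ip_sym _ _ (fun x => Im (v x))); ring.
Qed.

Definition weak_sol p g w := forall phi, test_fun Omega phi ->
  aform p (grad phi) g = rin phi w.

(** The real identity is enough: the imaginary part of the complex one at phi is the real one at
    ['i] phi. *)
Lemma grad_adjP p g w : coef Omega p -> L2n Omega g -> L2 Omega w ->
  grad_adj Omega (fun i x => (1 / p x)%:C * g i x) w <-> weak_sol p g w.
Proof.
move=> cp Lg Lw; have Lpg i : L2 Omega (weight (fun x => 1 / p x) (g i)).
  exact: L2_coef_weight.
have inE phi : test_fun Omega phi ->
    innern Omega (grad phi) (fun i => weight (fun x => 1 / p x) (g i)) =
    aform p (grad phi) g +i* aform p (grad (fun x => 'i * phi x)) g.
  move=> tphi; have [Lphi Lgphi] := test_fun_L2 oO tphi.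
  rewrite /innern /aform -complex_sum; apply: eq_bigr => i _.
  by rewrite (innerE mO (Lgphi i) (Lpg i)) (grad_mulC _ i tphi).
split=> [[_ _ H] phi tphi|H].
  have [Lphi _] := test_fun_L2 oO tphi.
  by have := H _ tphi; rewrite inE// (innerE mO Lphi Lw) => -[].
split=> // phi tphi; have [Lphi _] := test_fun_L2 oO tphi.
rewrite inE// (innerE mO Lphi Lw) (H _ tphi); congr Complex.
exact: H (test_fun_mulC _ tphi).
Qed.

Lemma diffusionP p u w : coef Omega p -> diffusion Omega p u w <->
  exists g, [/\ W10 u g, L2 Omega w & weak_sol p g w].
Proof.
move=> cp; split=> [[g [/(W1_0P oO) Wug H]]|[g [Wug Lw H]]]; exists g.
  have [_ Lw _] := H; have [_ Lg _] := Wug.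
  by split=> //; apply/(grad_adjP cp Lg Lw).
by split; [exact/(W1_0P oO)|have [_ Lg _] := Wug; apply/(grad_adjP cp Lg Lw)].
Qed.

(** Both sides are continuous along the test functions that approximate v. It allows the equation of
    one solution to be tested with another solution, even one that belongs to a different
    coefficient. *)
Lemma weak_sol_W10 p g w v h : coef Omega p -> L2n Omega g -> L2 Omega w ->
  weak_sol p g w -> W10 v h -> aform p h g = rin v w.
Proof.
move=> cp Lg Lw sol [Lv Lh [phi [tphi cphi gphi]]].
have c1 := rin_cvg mO (fun k => (test_fun_L2 oO (tphi k)).1) Lv (fun=> Lw) Lw cphi
  (cvL2_cst oO Lw).
have c2 := aform_cvg cp (fun k => (test_fun_L2 oO (tphi k)).2) Lh (fun=> Lg) Lg gphi
  (fun i => cvL2_cst oO (Lg i)).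
rewrite -(cvg_lim _ c2)//; apply/cvg_lim => //.
by under eq_fun => k do rewrite (sol _ (tphi k)).
Qed.

End diffusion_operator.

(** * Weak solutions by minimisation *)

Section solvability.
Variables (R : realType) (n : nat) (Omega : set 'rV[R]_n).
Hypothesis oO : open Omega.
Let mO : measurable Omega := measurable_open_rV oO.
Local Notation E := 'rV[R]_n.
Local Notation C := R[i].
Local Notation rin := (rin Omega).
Local Notation cvL2 := (cvL2 Omega).
Local Notation W10 := (W10 Omega).
Local Notation aform := (aform Omega).
Local Notation weak_sol := (weak_sol Omega).
Implicit Types (u v w f phi psi : E -> C) (g h : 'I_n -> E -> C) (p : E -> R).

Lemma L2_complete_rate (w_ : nat -> E -> C) (M : R) (delta : nat -> R) :
  0 <= M -> delta @ \oo --> (0 : R) -> (forall k, L2 Omega (w_ k)) ->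
  (forall k m, norm2 Omega (fun x => w_ k x - w_ m x) <= M * (delta k + delta m)) ->
  exists2 w, L2 Omega w & cvL2 w_ w.
Proof.
move=> M0 cd Lw bnd; apply: (L2_complete mO Lw) => e e0.
(* [M + 1] instead of [M], which may be 0. *)
have e0' : 0 < e / (2 * (M + 1)) by rewrite divr_gt0// mulr_gt0// ltr_wpDl.
have /cvgrPdist_le/(_ _ e0')[N _ HN] := cd.
exists N => j k Nj Nk; apply: (le_trans (bnd j k)).
have := HN j Nj; have := HN k Nk; rewrite !sub0r !normrN.
move=> /(le_trans (ler_norm _)) dk /(le_trans (ler_norm _)) dj.
have le_M : M * (delta j + delta k) <= M * (e / (M + 1)).
  apply: ler_wpM2l => //; apply: le_trans (lerD dj dk) _.
  by rewrite le_eqVlt; apply/orP; left; apply/eqP; field; lra.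
have M10 : 0 < M + 1 by rewrite ltr_wpDl.
apply: le_trans le_M _; rewrite mulrA ler_pdivrMr// mulrC ler_pM2l// lerDl//.
Qed.

(** Solves (A + eps) u = f weakly. It is used twice: with eps > 0, where the shift provides the
    coercivity, to derive the Poincare inequality; then with eps = 0, where that inequality is the
    coercivity, to invert A. *)
Lemma weak_exists p (eps K : R) f : coef Omega p -> 0 <= eps -> 0 <= K ->
  (forall phi, test_fun Omega phi ->
    rin phi phi <= K * (eps * rin phi phi + aform p (grad phi) (grad phi))) ->
  L2 Omega f ->
  exists u, exists g, W10 u g /\ forall phi, test_fun Omega phi ->
    eps * rin phi u + aform p (grad phi) g = rin phi f.
Proof.
move=> cp eps0 K0 coer Lf.
have tL phi : test_fun Omega phi -> L2 Omega phi by move=> /(test_fun_L2 oO)[].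
have tG phi : test_fun Omega phi -> L2n Omega (grad phi) by move=> /(test_fun_L2 oO)[].
pose B phi psi := eps * rin phi psi + aform p (grad phi) (grad psi).
have grad_combn phi t psi : test_fun Omega phi -> test_fun Omega psi ->
    grad (comb phi t psi) = combn (grad phi) t (grad psi).
  by move=> tphi tpsi; apply/funext => i; exact: grad_comb tphi tpsi.
have B_sym phi psi : test_fun Omega phi -> test_fun Omega psi -> B phi psi = B psi phi.
  by move=> _ _; rewrite /B rin_sym aform_sym.
have B_combl phi (t : R) psi chi : test_fun Omega phi -> test_fun Omega psi ->
    test_fun Omega chi -> B (comb phi t%:C psi) chi = B phi chi + t * B psi chi.
  move=> t1 t2 t3; rewrite /B (grad_combn _ _ _ t1 t2).
  rewrite (aform_combl oO _ cp (tG _ t1) (tG _ t2) (tG _ t3)).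
  rewrite (rin_combl mO _ (tL _ t1) (tL _ t2) (tL _ t3)).
  move: (rin phi chi) (rin psi chi) (aform _ _ _) (aform _ _ _) => a b c d; ring.
have B_ge phi : test_fun Omega phi -> aform p (grad phi) (grad phi) <= B phi phi.
  by move=> t1; rewrite /B lerDr mulr_ge0// rin_ge0.
have B_ge0 phi : test_fun Omega phi -> 0 <= B phi phi.
  by move=> t1; apply: le_trans (B_ge _ t1); apply: (aform_ge0 oO cp); exact: tG.
have [||||u_ [tu est cau]] := @minimizing_sequence R (E -> C) (test_fun Omega)
  (fun u t v => comb u t%:C v) B _ B_sym B_combl B_ge0 (fun phi => rin phi f) (K * rin f f).
- by move=> *; exact: test_fun_comb.
- by exists 0; exact: test_fun0.
- by move=> u t v tu tv; rewrite (rin_combl mO _ (tL _ tu) (tL _ tv) Lf).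
- move=> v tv; have Lv := tL _ tv.
  have := rin_CauchySchwarz mO Lv Lf.
  rewrite -(ler_pXn2r (ltn0Sn 1)) ?nnegrE ?mulr_ge0 ?norm2_ge0//.
  rewrite real_normK ?num_real// exprMn !sqr_norm2// => /le_trans; apply.
  by rewrite mulrAC ler_wpM2r ?rin_ge0//; exact: coer.
pose delta k : R := Num.sqrt k.+1%:R^-1.
have cdelta : delta @ \oo --> (0 : R).
  rewrite -(sqrtr0 R); apply: (@continuous_cvg _ _ _ _ _ _ (@Num.sqrt R)).
    exact: sqrt_continuous.
  exact: cvg_harmonic.
(* [cau] bounds the distance of two terms in the form [B]. Up to the factor K, [B] dominates the
   square of the L^2 norm, and by [aform_ge] up to the factor 1/m that of every partial derivative;
   so both functions and gradients converge. *)
have rate (M : R) w : 0 <= M -> L2 Omega w -> forall k m,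
    norm2 Omega w ^+ 2 <= M * B (comb (u_ k) (-1)%:C (u_ m)) (comb (u_ k) (-1)%:C (u_ m)) ->
    norm2 Omega w <= Num.sqrt M * (delta k + delta m).
  move=> M0 Lw k m Mw; apply: le_trans (_ : _ <= Num.sqrt M * Num.sqrt (B _ _)) _; last first.
    by apply: ler_wpM2l (cau k m); exact: sqrtr_ge0.
  rewrite -sqrtrM// -(ger0_norm (norm2_ge0 Omega w)) -sqrtr_sqr ler_sqrt//.
  by rewrite mulr_ge0// B_ge0//; exact: test_fun_comb.
have Lu k := tL _ (tu k); have Lgu k := tG _ (tu k).
have [k m|u Lu' cu] := @L2_complete_rate u_ _ delta (sqrtr_ge0 K) cdelta Lu.
  apply: rate => //; first exact: L2B.
  rewrite sub_comb sqr_norm2//; last exact: L2_comb.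
  by apply: coer; exact: test_fun_comb.
have [m m0 am] := aform_ge oO cp.
have /choice[g Hg] : forall i, exists gi, L2 Omega gi /\ cvL2 (fun k => grad (u_ k) i) gi.
  move=> i; have [k l|gi Lgi cgi] := @L2_complete_rate (fun k => grad (u_ k) i) _ delta
    (sqrtr_ge0 m^-1) cdelta (fun k => Lgu k i).
    apply: rate; [by rewrite invr_ge0 ltW|exact: (L2B mO (Lgu k i) (Lgu l i))|].
    have tc := test_fun_comb (-1)%:C (tu k) (tu l).
    rewrite -ler_pdivrMl ?invr_gt0// invrK; apply: le_trans (B_ge _ tc).
    apply: le_trans (am _ (tG _ tc)); apply: ler_wpM2l; first exact: ltW.
    rewrite (bigD1 i)//= (grad_comb _ i (tu k) (tu l)) -sub_comb lerDl.
    by apply: sumr_ge0 => j _; exact: sqr_ge0.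
  by exists gi.
have Lg : L2n Omega g by move=> i; case: (Hg i).
exists u, g; split.
  by split=> //; exists u_; split=> // i; case: (Hg i).
move=> phi tphi; have Lphi := tL _ tphi; have Lgphi := tG _ tphi.
(* [B (u_ k) phi] has two limits: this one by continuity of the form, and Re <phi | f> by the
   estimate [est]. Their equality is the equation. *)
have c1 : (fun k => B (u_ k) phi) @ \oo --> eps * rin u phi + aform p g (grad phi).
  apply: cvgD.
    apply: cvgM; first exact: cvg_cst.
    exact: (rin_cvg mO Lu Lu' (fun=> Lphi) Lphi cu (cvL2_cst oO Lphi)).
  apply: (aform_cvg oO cp Lgu Lg (fun=> Lgphi) Lgphi).
    by move=> i; case: (Hg i).
  by move=> i; exact: cvL2_cst.
rewrite rin_sym aform_sym -(cvg_lim _ c1)//; apply/cvg_lim => //.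
apply/(@subr_cvg0 R R^o); apply: (@norm_cvg0 R R^o).
have bnd : (fun k => delta k * Num.sqrt (B phi phi)) @ \oo --> (0 : R).
  by rewrite -(mul0r (Num.sqrt (B phi phi))); apply: cvgM => //; exact: cvg_cst.
apply: (@squeeze_cvgr _ _ _ _ (fun=> 0)) bnd; last exact: cvg_cst.
apply: nearW => k; rewrite normr_ge0 /= -sqrtr_sqr /delta -sqrtrM ?invr_ge0//.
rewrite ler_sqrt; first exact: est.
by rewrite mulr_ge0 ?B_ge0 ?invr_ge0.
Qed.

End solvability.

(** * Poincare inequality and bijectivity of the diffusion operator *)

Section bijectivity.
Variables (R : realType) (n : nat) (Omega : set 'rV[R]_n).
Hypothesis oO : open Omega.
Let mO : measurable Omega := measurable_open_rV oO.
Local Notation E := 'rV[R]_n.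
Local Notation C := R[i].
Local Notation rin := (rin Omega).
Local Notation cvL2 := (cvL2 Omega).
Local Notation W10 := (W10 Omega).
Local Notation aform := (aform Omega).
Local Notation weak_sol := (weak_sol Omega).
Implicit Types (u v w f phi psi : E -> C) (g h : 'I_n -> E -> C) (p : E -> R).

Lemma strictly_positive_rin p : coef Omega p ->
  strictly_positive Omega (diffusion Omega p) ->
  exists2 c : R, 0 < c & forall u g w, W10 u g -> L2 Omega w -> weak_sol p g w ->
    c * rin u u <= rin u w.
Proof.
move=> cp [c c0 Hc]; exists c => // u g w Wug Lw sol; have [Lu _ _] := Wug.
have : diffusion Omega p u w by apply/(diffusionP oO) => //; exists g.
by move=> /Hc; rewrite (innerE mO Lu Lw) lecE /= (sqr_norm2 mO Lu) => /andP[].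
Qed.

(* Solving [(A + c/2) u = phi] and testing with [phi] and [u] turns the lower
   bound [c] of [A], known on its domain only, into one of its form. *)
Lemma Poincare_test p : coef Omega p ->
  strictly_positive Omega (diffusion Omega p) ->
  exists2 K : R, 0 < K & forall phi, test_fun Omega phi ->
    rin phi phi <= K * aform p (grad phi) (grad phi).
Proof.
move=> cp /(strictly_positive_rin cp)[c c0 Hc].
exists (2 / c) => [|phi tphi]; first by rewrite divr_gt0.
have [Lphi Lgphi] := test_fun_L2 oO tphi; pose eps := c / 2.
have eps0 : 0 < eps by rewrite divr_gt0.
have [|psi tpsi|//|u [g [Wug sol]]] := @weak_exists _ _ _ oO p eps eps^-1 phi cp (ltW eps0).
- by rewrite invr_ge0 ltW.
(* The form of A is nonnegative, so the shift alone gives coercivity with the constant 1/eps. *)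
- rewrite mulrDr mulrA mulVf ?gt_eqF// mul1r lerDl mulr_ge0//.
    by rewrite invr_ge0 ltW.
  by apply: (aform_ge0 oO cp); have [] := test_fun_L2 oO tpsi.
have [Lu Lg _] := Wug.
have Lw : L2 Omega (comb phi (- eps)%:C u) by exact: L2_comb.
have solA : weak_sol p g (comb phi (- eps)%:C u).
  move=> psi tpsi; have [Lpsi _] := test_fun_L2 oO tpsi.
  by rewrite (rin_combr mO _ Lphi Lu Lpsi) -(sol _ tpsi) mulNr addrAC subrr add0r.
have Hcu := Hc _ _ _ Wug Lw solA.
have Hd := weak_sol_W10 oO cp Lg Lw solA Wug.
have Hphi := sol _ tphi.
(* [H2] and [H1] are the squares of phi - c u for the inner product and for the form. The first,
   with [Hcu], yields c <phi | u> <= |phi|^2. In the second, the mixed and the last term are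
   replaced by means of [Hphi] and [Hd], and c |phi|^2 <= 2 a(grad phi, grad phi) follows. *)
have H2 := rin_ge0 Omega (comb phi (- c)%:C u).
have H1 := aform_ge0 oO cp (g := combn (grad phi) (- c)%:C g)
  (fun i => L2_comb mO _ (Lgphi i) (Lg i)).
have U0 := rin_ge0 Omega u.
have Lc : L2 Omega (comb phi (- c)%:C u) by exact: L2_comb.
rewrite (rin_combr mO _ Lphi Lu Lu) (rin_sym _ u phi) in Hcu Hd.
rewrite (aform_sqr_combn oO cp Lgphi Lg) in H1.
rewrite (rin_combl mO _ Lphi Lu Lc) !(rin_combr mO _ Lphi Lu) ?(rin_sym _ u phi)// in H2.
move: (rin phi phi) (rin phi u) (rin u u) (aform p (grad phi) (grad phi))
  (aform p (grad phi) g) (aform p g g) Hcu Hd Hphi H2 H1 U0 => A s U a b d.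
rewrite /eps => Hcu Hd Hphi H2 H1 U0.
have cs : c * s <= A by nra.
have ccs : c * (c * s) <= c * A by rewrite ler_pM2l.
have cA : c * A <= 2 * a by rewrite -Hphi in ccs *; nra.
by rewrite mulrAC ler_pdivlMr// mulrC.
Qed.

Lemma Poincare p : coef Omega p -> strictly_positive Omega (diffusion Omega p) ->
  exists2 K : R, 0 < K & forall u g, W10 u g -> rin u u <= K * aform p g g.
Proof.
move=> cp /(Poincare_test cp)[K K0 HK]; exists K => // u g [Lu Lg [phi [tphi cphi gphi]]].
have Lphi k := (test_fun_L2 oO (tphi k)).1; have Lgphi k := (test_fun_L2 oO (tphi k)).2.
have c1 := rin_cvg mO Lphi Lu Lphi Lu cphi cphi.
have c2 := aform_cvg oO cp Lgphi Lg Lgphi Lg gphi gphi.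
have c3 : (fun k => K * aform p (grad (phi k)) (grad (phi k))) @ \oo --> K * aform p g g.
  by apply: cvgM => //; exact: cvg_cst.
apply: (ler_cvg_to c1 c3); apply: nearW => k; exact: HK.
Qed.

Lemma weak_sol_exists p f : coef Omega p -> strictly_positive Omega (diffusion Omega p) ->
  L2 Omega f -> exists u, exists g, W10 u g /\ weak_sol p g f.
Proof.
move=> cp /(Poincare_test cp)[K K0 HK] Lf.
have [phi tphi|//|u [g [Wug sol]]] := @weak_exists _ _ _ oO p 0 K f cp (lexx 0) (ltW K0).
  by rewrite mul0r add0r; exact: HK.
exists u, g; split=> // phi tphi; by rewrite -(sol _ tphi) mul0r add0r.
Qed.

Lemma weak_sol_unique p f u g u' g' : coef Omega p ->
  strictly_positive Omega (diffusion Omega p) -> L2 Omega f ->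
  W10 u g -> weak_sol p g f -> W10 u' g' -> weak_sol p g' f ->
  norm2 Omega (fun x => u x - u' x) = 0.
Proof.
move=> cp /(Poincare cp)[K K0 HK] Lf W s W' s'.
have [Lu Lg _] := W; have [Lu' Lg' _] := W'.
have Wd := W10_comb oO (-1)%:C W W'; have [Ld Lgd _] := Wd.
apply/eqP; rewrite -sqrf_eq0 sub_comb (sqr_norm2 mO Ld) eq_le rin_ge0 andbT.
apply: le_trans (HK _ _ Wd) _; rewrite (aform_combl oO _ cp Lg Lg' Lgd).
rewrite (aform_sym Omega p g) (aform_sym Omega p g').
rewrite (weak_sol_W10 oO cp Lg Lf s Wd) (weak_sol_W10 oO cp Lg' Lf s' Wd).
by rewrite mulN1r subrr mulr0.
Qed.

Lemma diffusion_bijective p : coef Omega p ->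
  strictly_positive Omega (diffusion Omega p) -> bijective_op Omega (diffusion Omega p).
Proof.
move=> cp sp f Lf; split.
  have [u [g [W s]]] := weak_sol_exists cp sp Lf.
  by exists u; apply/(diffusionP oO) => //; exists g.
move=> u u' /(diffusionP oO _ _ cp)[g [W _ s]] /(diffusionP oO _ _ cp)[g' [W' _ s']].
have [Lu _ _] := W; have [Lu' _ _] := W'.
by apply: (norm2_eq0_ae mO Lu Lu'); exact: weak_sol_unique cp sp Lf W s W' s'.
Qed.

Lemma op_inv_diffusion p f : coef Omega p ->
  strictly_positive Omega (diffusion Omega p) -> L2 Omega f ->
  exists g, W10 (op_inv (diffusion Omega p) f) g /\ weak_sol p g f.
Proof.
move=> cp sp Lf; have [ex _] := diffusion_bijective cp sp Lf.
have : diffusion Omega p (op_inv (diffusion Omega p) f) f by exact: (xgetPex (fun=> 0) ex).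
by move/(diffusionP oO _ _ cp) => [g [W _ s]]; exists g.
Qed.

End bijectivity.

(** * Monotone sequences of coefficients *)

Section monotone_limit.
Variables (R : realType) (n : nat) (Omega : set 'rV[R]_n).
Hypothesis oO : open Omega.
Let mO : measurable Omega := measurable_open_rV oO.
Local Notation E := 'rV[R]_n.
Local Notation C := R[i].
Local Notation Re := complex.Re.
Local Notation Im := complex.Im.
Local Notation mu := (lebesgue_rV R n).
Local Notation rin := (rin Omega).
Local Notation cvL2 := (cvL2 Omega).
Local Notation W10 := (W10 Omega).
Local Notation aform := (aform Omega).
Local Notation weak_sol := (weak_sol Omega).

Lemma aform_antimono (p q : E -> R) (g : 'I_n -> E -> C) : coef Omega p -> coef Omega q ->
  {ae mu, forall x, Omega x -> q x <= p x} -> L2n Omega g -> aform p g g <= aform q g g.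
Proof.
move=> cp cq qp Lg; apply: ler_sum => i _.
apply: (le_rin_weight mO (Lg i) (L2_coef_weight oO cp (Lg i)) (L2_coef_weight oO cq (Lg i))).
have [_ [C1 [C2 [C10 _ Cq]]]] := cq.
apply: filterS2 qp Cq => x Hqp HCq Ox.
have /andP[C1q _] := HCq Ox; have q0 : 0 < q x by exact: lt_le_trans C1q.
by rewrite !div1r lef_pV2 ?posrE ?Hqp//; exact: lt_le_trans (Hqp Ox).
Qed.

(** The weak equation is only a real identity, so the part [Im a] needs an argument:
    skew-adjointness moves ['i] onto the test function, and the equation of h is used at ['i]
    phi. *)
Lemma weak_sol_combC (p : E -> R) (g h : 'I_n -> E -> C) (w v : E -> C) a : coef Omega p ->
  L2n Omega g -> L2n Omega h -> L2 Omega w -> L2 Omega v ->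
  weak_sol p g w -> weak_sol p h v -> weak_sol p (combn g a h) (comb w a v).
Proof.
move=> cp Lg Lh Lw Lv sg sh phi tphi; have [Lphi Lgphi] := test_fun_L2 oO tphi.
have tiphi := test_fun_mulC 'i tphi.
rewrite aform_sym (rin_sym _ phi) (rin_combC mO _ Lw Lv Lphi) (rin_iC oO Lv Lphi) //.
have -> : aform p (combn g a h) (grad phi) = aform p g (grad phi) +
    Re a * aform p h (grad phi) - Im a * aform p h (grad (fun x => 'i * phi x)).
  rewrite /aform !mulr_sumr -big_split -sumrB /=; apply: eq_bigr => i _.
  have Lw' := L2_coef_weight oO cp (Lgphi i).
  rewrite (rin_combC mO _ (Lg i) (Lh i) Lw') (rin_iC oO (Lh i) Lw') (grad_mulC _ i tphi).
  rewrite mulrN; congr (_ - Im a * rin _ _).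
  by apply/funext => x; rewrite /weight mulrCA.
rewrite !(aform_sym Omega p _ (grad _)) (sg _ tphi) (sh _ tphi) (sh _ tiphi).
by rewrite !(rin_sym _ _ phi) (rin_sym _ v) mulrN.
Qed.

(** Expand a_p at g - h. Tested with u and v, the equation of u gives a_p(g, g) = <f | u> and a_p(g,
    h) = <f | v>, up to real parts. The remaining term a_p(h, h) is at most a_q(h, h), which is <f |
    v> by the equation of v; one of the two copies of - <f | v> absorbs it. *)
Lemma weak_sol_sqdist (p0 p q : E -> R) (K : R) (f u v : E -> C) (g h : 'I_n -> E -> C) :
  coef Omega p0 -> coef Omega p -> coef Omega q ->
  {ae mu, forall x, Omega x -> p x <= p0 x} -> {ae mu, forall x, Omega x -> q x <= p x} ->
  0 < K -> (forall w k, W10 w k -> rin w w <= K * aform p0 k k) -> L2 Omega f ->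
  W10 u g -> weak_sol p g f -> W10 v h -> weak_sol q h f ->
  norm2 Omega (fun x => u x - v x) ^+ 2 <= K * (rin f u - rin f v).
Proof.
move=> cp0 cp cq pp0 qp K0 HK Lf W s V t; have [Lu Lg _] := W; have [Lv Lh _] := V.
have Wd := W10_comb oO (-1)%:C W V; have [Ld Lgd _] := Wd.
rewrite sub_comb (sqr_norm2 mO Ld); apply: le_trans (HK _ _ Wd) _; rewrite ler_pM2l//.
apply: le_trans (aform_antimono cp0 cp pp0 Lgd) _.
have := aform_antimono cp cq qp Lh.
rewrite (aform_sqr_combn oO cp Lg Lh) (aform_sym Omega p g h).
rewrite (weak_sol_W10 oO cp Lg Lf s W) (weak_sol_W10 oO cp Lg Lf s V).
rewrite (weak_sol_W10 oO cq Lh Lf t V) !(rin_sym Omega f).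
move: (rin u f) (rin v f) (aform p h h) => a b c cb.
rewrite sqrrN expr1n mul1r mulrN1; lra.
Qed.

Variable p : nat -> E -> R.
Hypothesis cp : forall nu, coef Omega (p nu).
Hypothesis sp : forall nu, strictly_positive Omega (diffusion Omega (p nu)).
Hypothesis decr : forall nu, {ae mu, forall x, Omega x -> p nu.+1 x <= p nu x}.

Let sol f nu := op_inv (diffusion Omega (p nu)) f.

Let L2_sol f nu : L2 Omega f -> L2 Omega (sol f nu).
Proof. by move=> Lf; have [g [[]]] := op_inv_diffusion oO (cp nu) (sp nu) Lf. Qed.

Lemma ae_decr nu xi : (nu <= xi)%N ->
  {ae mu, forall x, Omega x -> p xi x <= p nu x}.
Proof.
move=> /subnK <-; elim: (xi - nu)%N => [|k IH]; first by apply: aeW => x _.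
by apply: filterS2 IH (decr (k + nu)) => x H1 H2 Ox; apply: le_trans (H1 Ox); exact: H2.
Qed.

(** [K] is chosen before f, because the first estimate is also the source of the bound on the norm
    of the limit operator. *)
Lemma sol_sqdist_le : exists2 K : R, 0 < K & forall f, L2 Omega f ->
  (forall nu, rin (sol f nu) (sol f nu) <= K * rin f (sol f nu)) /\
  (forall nu xi, (nu <= xi)%N ->
    norm2 Omega (fun x => sol f nu x - sol f xi x) ^+ 2 <=
    K * (rin f (sol f nu) - rin f (sol f xi))).
Proof.
have [K K0 HK] := Poincare oO (cp 0) (sp 0).
exists K => // f Lf; split=> [nu|nu xi numu].
  have [g [W s]] := op_inv_diffusion oO (cp nu) (sp nu) Lf; have [_ Lg _] := W.
  apply: le_trans (HK _ _ W) _; rewrite ler_pM2l//.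
  apply: le_trans (aform_antimono (cp 0) (cp nu) (ae_decr (leq0n nu)) Lg) _.
  by rewrite (weak_sol_W10 oO (cp nu) Lg Lf s W) rin_sym.
have [g [W s]] := op_inv_diffusion oO (cp nu) (sp nu) Lf.
have [h [V t]] := op_inv_diffusion oO (cp xi) (sp xi) Lf.
exact: (weak_sol_sqdist (cp 0) (cp nu) (cp xi) (ae_decr (leq0n nu)) (ae_decr numu) K0 HK Lf
  W s V t).
Qed.

Lemma sol_cvg f : L2 Omega f -> exists2 v, L2 Omega v & cvL2 (sol f) v.
Proof.
move=> Lf; have [K K0 /(_ f Lf)[bK dK]] := sol_sqdist_le.
pose s nu := rin f (sol f nu).
have s_decr : nonincreasing_seq s.
  move=> nu xi numu; rewrite -subr_ge0 -(pmulr_rge0 _ K0).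
  by apply: le_trans (dK _ _ numu); exact: sqr_ge0.
have s_ge0 nu : 0 <= s nu.
  by rewrite -(pmulr_rge0 _ K0); apply: le_trans (bK nu); exact: rin_ge0.
have cs : cvgn s.
  by apply: nonincreasing_is_cvgn => //; exists 0 => _ [nu _ <-].
apply: (L2_complete mO (fun nu => L2_sol nu Lf)) => e e0.
(* For indices nu <= xi, the squared distance is at most K (s nu - s xi), hence at most K (s nu -
   lim s); this should not exceed e^2. *)
have e20 : 0 < e ^+ 2 / K by rewrite divr_gt0// exprn_gt0.
have /cvgrPdist_lt/(_ _ e20)[N _ HN] := cs.
have lim_le nu : limn s <= s nu by exact: nonincreasing_cvgn_ge.
have half nu xi : (N <= nu)%N -> (nu <= xi)%N ->
    norm2 Omega (fun x => sol f nu x - sol f xi x) <= e.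
  move=> Nnu numu; rewrite -(ler_pXn2r (ltn0Sn 1)) ?nnegrE ?norm2_ge0 ?(ltW e0)//.
  apply: le_trans (dK _ _ numu) _; rewrite mulrC -ler_pdivlMr//.
  have := HN nu Nnu; rewrite /= distrC => /(le_lt_trans (ler_norm _))/ltW H.
  by apply: le_trans H; rewrite lerD2l lerN2; exact: lim_le.
exists N => j k Nj Nk; have [jk|/ltnW kj] := leqP j k; first exact: half.
by rewrite (norm2_subC mO (L2_sol j Lf) (L2_sol k Lf)); exact: half.
Qed.

(** A representative of the limit is chosen for each f separately, with default 0 if there is none.
    Two limits agree only almost everywhere, which is why linearity of [T] has to be recovered up to
    a null set. *)
Let T f := xget (fun=> 0) [set v | L2 Omega v /\ cvL2 (sol f) v].

Let TP f : L2 Omega f -> L2 Omega (T f) /\ cvL2 (sol f) (T f).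
Proof.
move=> Lf; have [v Lv cv] := sol_cvg Lf.
by rewrite /T; case: xgetP => [w _ []//|/(_ v)]; case.
Qed.

Let rin_sol_cvg f g : L2 Omega f -> L2 Omega g ->
  (fun nu => rin (sol f nu) g) @ \oo --> rin (T f) g.
Proof.
move=> Lf Lg; have [LT cT] := TP Lf.
exact: (rin_cvg mO (fun nu => L2_sol nu Lf) LT (fun=> Lg) Lg cT (cvL2_cst oO Lg)).
Qed.

Let sol_sym f g nu : L2 Omega f -> L2 Omega g ->
  rin (sol f nu) g = rin f (sol g nu) /\
  rin (fun x => 'i * sol f nu x) g = rin (fun x => 'i * f x) (sol g nu).
Proof.
move=> Lf Lg.
have [h [W s]] := op_inv_diffusion oO (cp nu) (sp nu) Lf; have [_ Lh _] := W.
have [k [V t]] := op_inv_diffusion oO (cp nu) (sp nu) Lg; have [_ Lk _] := V.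
(* ['i - 1] comes from [mulC_comb]: the combination is ['i] times the solution, and by [is_] it
   solves the equation with right-hand side ['i] f. *)
have iW := W10_comb oO ('i - 1) W W; have [_ Lih _] := iW.
have Lif : L2 Omega (comb f ('i - 1) f) by exact: L2_comb.
have is_ := weak_sol_combC ('i - 1) (cp nu) Lh Lh Lf Lf s s.
rewrite !mulC_comb; split.
  rewrite -(weak_sol_W10 oO (cp nu) Lk Lg t W) aform_sym.
  by rewrite (weak_sol_W10 oO (cp nu) Lh Lf s V) rin_sym.
rewrite -(weak_sol_W10 oO (cp nu) Lk Lg t iW) aform_sym.
by rewrite (weak_sol_W10 oO (cp nu) Lih Lif is_ V) rin_sym.
Qed.

Let sol_lin a f g nu : L2 Omega f -> L2 Omega g ->
  norm2 Omega (fun x => sol (fun x => a * f x + g x) nu x -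
    comb (sol g nu) a (sol f nu) x) = 0.
Proof.
move=> Lf Lg; have Lfg : L2 Omega (comb g a f) by exact: L2_comb.
have -> : (fun x => a * f x + g x) = comb g a f by apply/funext => x; rewrite /comb addrC.
have [h [W s]] := op_inv_diffusion oO (cp nu) (sp nu) Lf; have [_ Lh _] := W.
have [k [V t]] := op_inv_diffusion oO (cp nu) (sp nu) Lg; have [_ Lk _] := V.
have [l [X r]] := op_inv_diffusion oO (cp nu) (sp nu) Lfg.
apply: (weak_sol_unique oO (cp nu) (sp nu) Lfg X r (W10_comb oO a V W)).
exact: weak_sol_combC.
Qed.

Let T_lin a f g : L2 Omega f -> L2 Omega g ->
  ae_eqO Omega (T (fun x => a * f x + g x)) (fun x => a * T f x + T g x).
Proof.
move=> Lf Lg; have [LTf cTf] := TP Lf; have [LTg cTg] := TP Lg.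
have Lfg : L2 Omega (fun x => a * f x + g x).
  have := L2_comb mO a Lg Lf; congr L2.
  by apply/funext => x; rewrite /comb addrC.
have [LT cT] := TP Lfg.
have -> : (fun x => a * T f x + T g x) = comb (T g) a (T f).
  by apply/funext => x; rewrite /comb addrC.
have LC : L2 Omega (comb (T g) a (T f)) by exact: L2_comb.
apply: (norm2_eq0_ae mO LT LC).
(* The solutions for a f + g tend to both functions: to the first by choice of [T], to the second
   because they are at distance 0 from the combined solutions. *)
apply: (L2_lim_unique oO (fun nu => L2_sol nu Lfg) LT LC cT).
have := cvL2_comb oO a (fun nu => L2_sol nu Lg) LTg (fun nu => L2_sol nu Lf) LTf cTg cTf.
apply: (@squeeze_cvgr _ _ _ _ (fun=> 0)); last exact: cvg_cst.
apply: nearW => nu; rewrite norm2_ge0 /=.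
have Lc : L2 Omega (comb (sol g nu) a (sol f nu)) by apply: L2_comb => //; exact: L2_sol.
apply: le_trans (norm2_sub_le mO (L2_sol nu Lfg) Lc LC) _.
by rewrite sol_lin// add0r.
Qed.

(** In the limit, the first estimate of [sol_sqdist_le] reads |T f|^2 <= K Re <T f | f>.
    Cauchy-Schwarz bounds this by K |T f| |f|, and one factor |T f| cancels unless it is 0. *)
Let T_bounded : exists M : R, forall f, L2 Omega f ->
  norm2 Omega (T f) <= M * norm2 Omega f.
Proof.
have [K K0 HK] := sol_sqdist_le; exists K => f Lf; have [bK _] := HK f Lf.
have [LT cT] := TP Lf.
have c1 := rin_cvg mO (fun nu => L2_sol nu Lf) LT (fun nu => L2_sol nu Lf) LT cT cT.
have c2 : (fun nu => K * rin (sol f nu) f) @ \oo --> K * rin (T f) f.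
  by apply: cvgM; [exact: cvg_cst|exact: rin_sol_cvg].
have le_T : rin (T f) (T f) <= K * rin (T f) f.
  by apply: (ler_cvg_to c1 c2); apply: nearW => nu; rewrite (rin_sym _ _ f); exact: bK.
have := le_trans (ler_norm _) (rin_CauchySchwarz mO LT Lf); move: le_T.
rewrite -(sqr_norm2 mO LT); have := norm2_ge0 Omega (T f); have := norm2_ge0 Omega f.
move: (norm2 Omega (T f)) (norm2 Omega f) (rin (T f) f) => y x z x0 y0 yz zyx.
have [->|y_neq0] := eqVneq y 0; first by rewrite mulr_ge0// ltW.
rewrite -(ler_pM2l (_ : 0 < y)) ?lt_neqAle 1?eq_sym ?y_neq0//.
by rewrite -expr2 (le_trans yz)// mulrCA ler_pM2l.
Qed.

Let rin_T_sym f g : L2 Omega f -> L2 Omega g -> rin (T f) g = rin f (T g).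
Proof.
move=> Lf Lg; have c1 := rin_sol_cvg Lf Lg; have c2 := rin_sol_cvg Lg Lf.
have e : (fun nu => rin (sol f nu) g) = (fun nu => rin (sol g nu) f).
  by apply/funext => nu; exact: etrans (sol_sym nu Lf Lg).1 (rin_sym Omega f (sol g nu)).
rewrite e in c1; apply: etrans (rin_sym Omega (T g) f).
exact: etrans (esym (cvg_lim (@Rhausdorff R) c1)) (cvg_lim (@Rhausdorff R) c2).
Qed.

Let rin_T_sym_i f g : L2 Omega f -> L2 Omega g ->
  rin (T f) (fun x => 'i * g x) = - rin (fun x => 'i * f x) (T g).
Proof.
move=> Lf Lg; have Lif := L2_mulC mO 'i Lf; have Lig := L2_mulC mO 'i Lg.
have c1 := rin_sol_cvg Lf Lig.
have c2 : (fun nu => - rin (sol g nu) (fun x => 'i * f x)) @ \oo -->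
    - rin (T g) (fun x => 'i * f x) by apply: cvgN; exact: rin_sol_cvg.
have e : (fun nu => rin (sol f nu) (fun x => 'i * g x)) =
    (fun nu => - rin (sol g nu) (fun x => 'i * f x)).
  apply/funext => nu; apply: oppr_inj; rewrite opprK.
  apply: etrans (esym (rin_iC oO (L2_sol nu Lf) Lg)) _.
  exact: etrans (sol_sym nu Lf Lg).2 (rin_sym Omega (fun x => 'i * f x) (sol g nu)).
rewrite e in c1; rewrite (rin_sym Omega (fun x => 'i * f x)).
exact: etrans (esym (cvg_lim (@Rhausdorff R) c1)) (cvg_lim (@Rhausdorff R) c2).
Qed.

Lemma inverse_strong_limit : exists T : (E -> C) -> (E -> C),
  [/\ bounded_linear_op Omega T, bounded_self_adjoint Omega T, positive_op Omega T &
    forall f, L2 Omega f -> (fun nu => norm2 Omega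
      (fun x => op_inv (diffusion Omega (p nu)) f x - T f x)) @ \oo --> (0 : R)].
Proof.
exists T; split.
- split; first by move=> f /TP[].
    by move=> a f g Lf Lg; exact: T_lin.
  exact: T_bounded.
- move=> f g Lf Lg; have [LTf _] := TP Lf; have [LTg _] := TP Lg.
  rewrite (innerE mO LTf Lg) (innerE mO Lf LTg) rin_T_sym//; congr Complex.
  by rewrite (rin_iC oO LTf Lg) rin_T_sym_i// opprK.
- move=> f Lf; have [LT _] := TP Lf.
  (* The order of [R[i]] requires <f | T f> to be real. By [rin_T_sym_i] at the pair f, f, its
     imaginary part equals its own opposite. *)
  have iT0 : rin (fun x => 'i * f x) (T f) = 0.
    by have := rin_T_sym_i Lf Lf; rewrite rin_sym; lra.
  rewrite (innerE mO Lf LT) iT0 lecE /= eqxx /=.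
  have [K K0 /(_ f Lf)[bK _]] := sol_sqdist_le.
  rewrite (rin_sym Omega f); apply: (ler_cvg_to (cvg_cst 0) (rin_sol_cvg Lf Lf)).
  apply: nearW => nu; rewrite (rin_sym Omega (sol f nu)) -(pmulr_rge0 _ K0).
  by apply: le_trans (bK nu); exact: rin_ge0.
- by move=> f /TP[].
Qed.

End monotone_limit.

(** Indices start at 0, so [p nu] is the coefficient of index nu + 1 in the English statement.
    Bijectivity is part of the conclusion because it gives [op_inv] its meaning: where there is no
    preimage, [op_inv] takes the default value 0. *)
Theorem lemma3p1p1 (R : realType) (n : nat) (hn : (1 <= n)%N)
  (Omega : set 'rV[R]_n) (hopen : open Omega) (hne : Omega !=set0)
  (hpos : forall q : 'rV[R]_n -> R, coef Omega q ->
    strictly_positive Omega (diffusion Omega q))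
  (p : nat -> 'rV[R]_n -> R) (hp : forall nu, coef Omega (p nu))
  (hdecr : forall nu,
    {ae lebesgue_rV R n, forall x, Omega x -> p nu.+1 x <= p nu x}) :
  (forall nu, bijective_op Omega (diffusion Omega (p nu))) /\
  exists T : ('rV[R]_n -> R[i]) -> ('rV[R]_n -> R[i]),
    [/\ bounded_linear_op Omega T,
        bounded_self_adjoint Omega T,
        positive_op Omega T &
        forall f, L2 Omega f ->
          (fun nu => norm2 Omega
            (fun x => op_inv (diffusion Omega (p nu)) f x - T f x)) @ \oo
            --> (0 : R)].
Proof.
have sp nu := hpos _ (hp nu); split=> [nu|].
  exact: (@diffusion_bijective _ _ _ hopen _ (hp nu) (sp nu)).
exact (@inverse_strong_limit _ _ _ hopen p hp sp hdecr).
Qed.
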